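(* There exists a family $(A_{\alpha})_{\alpha\in 2^\omega}$ of subsets of $2^\omega\times 2^\omega$, each of which is a difference of two open sets (i.e. in $D_2(\mathbf{\Sigma}^0_1)(2^\omega\times 2^\omega)$), which is a perfect $\leq^r_c$-antichain, and such that for every $\alpha\in 2^\omega$ the set $A_\alpha$ is $\leq^r_c$-minimal among Borel sets that are not potentially closed; that is, $A_\alpha$ is not potentially closed, and whenever $Y,Y'$ are Polish spaces and $B\subseteq Y\times Y'$ is a Borel set which is not potentially closed and satisfies $B\leq^r_c A_\alpha$, then $A_\alpha\leq^r_c B$.
   Context: A Borel set $A\subseteq X\times Y$ ($X,Y$ Polish) is potentially closed ($A\in\mathrm{pot}(\mathbf{\Pi}^0_1)$) if there are Polish topologies $\sigma$ on $X$ finer than the original topology and $\tau$ on $Y$ finer than the original topology such that $A$ is closed in $[X,\sigma]\times[Y,\tau]$. For $A\subseteq X\times Y$ and $A'\subseteq X'\times Y'$ (all spaces Polish), $A\leq^r_c A'$ means there are continuous maps $u:X\to X'$, $v:Y\to Y'$ with $A=(u\times v)^{-1}(A')$. A family $(A_\alpha)_{\alpha\in 2^\omega}$ of Borel sets is a perfect antichain for a quasi-order $\leq$ if $A_\alpha\not\leq A_{\alpha'}$ whenever $\alpha\neq\alpha'$, and the map $\alpha\mapsto A_\alpha$ is continuous in the codes, i.e. there is a continuous $c:2^\omega\to 2^\omega$ such that $c(\alpha)$ is a Borel code for $A_\alpha$ for each $\alpha$. *)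

(* Defs.v *)
From HB Require Import structures.
From mathcomp Require Import all_boot all_order all_algebra.
From mathcomp Require Import all_classical all_reals all_analysis.

Set Implicit Arguments.
Unset Strict Implicit.
Unset Printing Implicit Defensive.

Local Open Scope classical_set_scope.

(* Separable and completely metrizable. The metric [m] is a metric structure
   on the carrier of [T], which a priori carries its own topology: it is
   required to induce the topology of [T]. All choices of the field [R] of
   real numbers give the same notion. *)
Definition polish (R : realType) (T : topologicalType) : Prop :=
  (exists2 D : set T, countable D & dense D) /\
  exists m : Metric R T,
    let M : metricType R := Metric.Pack m in
    (forall x : T, @nbhs M M x = @nbhs T T x) /\
    (forall F : set_system M, ProperFilter F -> cauchy F ->
       exists l : M, F --> l).

Definition borel (T : topologicalType) : set (set T) := <<s open >>.

(* [s] ranges over the topologies on the carrier of [X]. *)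
Definition finer_polish (R : realType) (X : topologicalType)
    (s : Topological X) : Prop :=
  let Xs : topologicalType := Topological.Pack s in
  polish R Xs /\ (forall U : set X, @open X U -> @open Xs U).

(* [closed] refers to the product of the two finer topologies. *)
Definition pot_closed (R : realType) (X Y : topologicalType)
    (A : set (X * Y)) : Prop :=
  exists (s : Topological X) (t : Topological Y),
    let Xs : topologicalType := Topological.Pack s in
    let Yt : topologicalType := Topological.Pack t in
    [/\ finer_polish R s, finer_polish R t & @closed (Xs * Yt)%type A].

Definition red_c (X Y X' Y' : topologicalType)
    (A : set (X * Y)) (A' : set (X' * Y')) : Prop :=
  exists (u : X -> X') (v : Y -> Y'),
    [/\ continuous u, continuous v &
        A = (fun p => (u p.1, v p.2)) @^-1` A'].

Definition diff_open (T : topologicalType) (A : set T) : Prop :=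
  exists U V : set T, [/\ open U, open V & A = U `\` V].

Definition minimal_non_pot_closed (R : realType) (X X' : topologicalType)
    (A : set (X * X')) : Prop :=
  [/\ borel A, ~ pot_closed R A &
      forall (Y Y' : topologicalType) (B : set (Y * Y')),
        polish R Y -> polish R Y' -> borel B -> ~ pot_closed R B ->
        red_c B A -> red_c A B].

Definition cylinder (s : seq bool) : set cantor_space :=
  [set x | forall i, (i < size s)%N -> x i = nth false s i].

(* An enumeration of the basis of products of cylinders (and of the empty
   set, at the indices that are not codes of pairs of words). *)
Definition basic_open (n : nat) : set (cantor_space * cantor_space) :=
  if (unpickle n : option (seq bool * seq bool)) is Some (s, t)
  then cylinder s `*` cylinder t else set0.

(* [borel_code c A]: the point [c] of the Cantor space is a Borel code for
   [A]. The first bits tell how [A] is built: "1" announces an open set,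
   "01" a complement, and "00" a countable union; in the last case the rest of
   [c] is cut into countably many codes by the pairing [pickle (i, n)] of
   natural numbers. Being inductive, the predicate only accepts well-founded
   codes. *)
Inductive borel_code :
    cantor_space -> set (cantor_space * cantor_space) -> Prop :=
| borel_code_open (c : cantor_space) :
    c 0%N = true ->
    borel_code c (\bigcup_(n in [set n | c n.+1 = true]) basic_open n)
| borel_code_compl (c : cantor_space) (A : set (cantor_space * cantor_space)) :
    c 0%N = false -> c 1%N = true ->
    borel_code (fun n => c n.+2) A ->
    borel_code c (~` A)
| borel_code_bigcup (c : cantor_space)
      (F : nat -> set (cantor_space * cantor_space)) :
    c 0%N = false -> c 1%N = false ->
    (forall i, borel_code (fun n => c (pickle (i, n)).+2) (F i)) ->
    borel_code c (\bigcup_i F i).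

Definition perfect_antichain
    (le : set (cantor_space * cantor_space) ->
          set (cantor_space * cantor_space) -> Prop)
    (A : cantor_space -> set (cantor_space * cantor_space)) : Prop :=
  [/\ forall a, borel (A a),
      forall a b, a <> b -> ~ le (A a) (A b) &
      exists2 c : cantor_space -> cantor_space,
        continuous c & forall a, borel_code (c a) (A a)].

(* Main.v *)
Require Import Defs.
From HB Require Import structures.
From mathcomp Require Import all_boot all_order all_algebra lra.
From mathcomp Require Import all_classical all_reals all_analysis.

(** For [S : nat -> bool] let [A_S] be the set of pairs [(x, y)] such that [y] is
    obtained from [x] by turning the [k]-th bit from 0 to 1, for some [k] such
    that the number [w] of ones of [x] before [k] satisfies [S w]. Its closure
    only adds points of the diagonal, so [A_S] is a difference of open sets.

    If every pattern of [S] recurs with bounded gaps, [A_S] is minimal. Let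
    [B = (u x v)^-1(A_S)] and let [D] be the set of common values of [u] and [v].
    If the analytic set [D] is covered by countably many Borel sets containing no
    two points that differ by one flip, then making the preimages of these sets
    open makes [B] closed. Otherwise one finds inside [D] arbitrarily large cubes
    of flips, all positive again with respect to this sigma-ideal; the weights at
    the last flip of an [m]-cube fill an interval of length [m], so one can choose
    the flips at positions where [S] looks like its initial segment. A fusion of
    these cubes is a reduction of [A_S] to [B]. By Lusin separation and the Baire
    category theorem, [A_S] itself is not potentially closed.

    A reduction of [A_S] to [A_S'] is of the form [u x u], and near the point 0 it
    carries cubes of flips to cubes of flips; comparing weights, every prefix of
    [S] occurs in [S']. For the Toeplitz words [n |-> x (v_2 (n + 1))], where [x]
    takes both values infinitely often, this determines [x]. *)

Set Implicit Arguments.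
Unset Strict Implicit.
Unset Printing Implicit Defensive.

Local Open Scope classical_set_scope.
Local Open Scope nat_scope.

(** * Dependent choice, and sequences that agree up to a given length *)

Lemma dep_choice (T : Type) (P : nat -> T -> Prop) (Q : nat -> T -> T -> Prop)
    (x0 : T) :
  P 0 x0 -> (forall n x, P n x -> exists y, P n.+1 y /\ Q n x y) ->
  exists f : nat -> T, f 0 = x0 /\ forall n, P n (f n) /\ Q n (f n) (f n.+1).
Proof.
move=> P0 PS.
have /choice[g gP] : forall p : nat * T, exists y, P p.1 p.2 ->
    P p.1.+1 y /\ Q p.1 p.2 y.
  move=> [n x]; have [/PS[y yP]|nP] := pselect (P n x); first by exists y.
  by exists x.
pose f := nat_rect (fun=> T) x0 (fun n x => g (n, x)).
have Pf n : P n (f n).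
  by elim: n => //= n IHn; have [] := gP (n, f n) IHn.
by exists f; split=> // n; split=> //; have [] := gP (n, f n) (Pf n).
Qed.

Section Agree.
Variable T : Type.
Implicit Types x y z : nat -> T.

Definition agree n x y := forall i, i < n -> x i = y i.

Lemma agree_refl n x : agree n x x. Proof. by []. Qed.

Lemma agree_sym n x y : agree n x y -> agree n y x.
Proof. by move=> xy i /xy. Qed.

Lemma agree_trans n y x z : agree n x y -> agree n y z -> agree n x z.
Proof. by move=> xy yz i ltin; rewrite xy ?yz. Qed.

Lemma agree_le m n x y : m <= n -> agree n x y -> agree m x y.
Proof. by move=> lemn xy i ltim; apply/xy/(leq_trans ltim). Qed.

Lemma agree_all x y : (forall n, agree n x y) -> x = y.
Proof. by move=> xy; apply/funext => i; apply: (xy i.+1). Qed.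

Lemma agree_lim (x : nat -> nat -> T) :
  (forall n, agree n (x n) (x n.+1)) -> exists y, forall n, agree n y (x n).
Proof.
move=> xS; exists (fun i => x i.+1 i) => n i ltin.
rewrite -(subnK ltin); elim: (n - i.+1) => //= d ->.
by rewrite addSn; apply: xS; rewrite addnS ltnS leq_addl.
Qed.

Definition update x n v : nat -> T := fun i => if i == n then v else x i.

Lemma update_agree x n v : agree n x (update x n v).
Proof. by move=> i ltin; rewrite /update ltn_eqF. Qed.

Lemma agree_update n x y : agree n x y -> agree n.+1 (update x n (y n)) y.
Proof.
move=> xy i; rewrite ltnS leq_eqVlt /update => /orP[/eqP->|ltin].
  by rewrite eqxx.
by rewrite ltn_eqF ?xy.
Qed.

End Agree.

(** Continuity for products of discrete spaces, stated on bare functions: it serves the Baire space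
    and the Cantor space alike. *)
Definition seq_continuous (T U : Type) (f : (nat -> T) -> nat -> U) :=
  forall x n, exists m, forall y, agree m x y -> agree n (f x) (f y).

Lemma seq_continuous_comp T U V (g : (nat -> U) -> nat -> V) (f : (nat -> T) -> nat -> U) :
  seq_continuous g -> seq_continuous f -> seq_continuous (g \o f).
Proof.
move=> gc fc x n; have [m mP] := gc (f x) n; have [p pP] := fc x m.
by exists p => y /pP /mP.
Qed.

(** * Flips of bits *)

Definition xorw (m x : nat -> bool) : nat -> bool := fun i => m i (+) x i.
Definition delta (k : nat) : nat -> bool := fun i => i == k.
Fixpoint weight (x : nat -> bool) (k : nat) : nat :=
  if k is j.+1 then weight x j + x j else 0.

Lemma xorwK m : involutive (xorw m).
Proof. by move=> x; apply/funext => i; rewrite /xorw addKb. Qed.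

Lemma xorwCA m m' x : xorw m (xorw m' x) = xorw m' (xorw m x).
Proof. by apply/funext => i; rewrite /xorw addbCA. Qed.

Lemma xorwA m m' x : xorw m (xorw m' x) = xorw (xorw m m') x.
Proof. by apply/funext => i; rewrite /xorw addbA. Qed.

Lemma xorw0 x : xorw (fun=> false) x = x. Proof. by apply/funext. Qed.

Lemma xorw_agree m n x y : agree n x y -> agree n (xorw m x) (xorw m y).
Proof. by move=> xy i ltin; rewrite /xorw xy. Qed.

Lemma xorw_seq_continuous m : seq_continuous (xorw m).
Proof. by move=> x n; exists n => y; apply: xorw_agree. Qed.

Lemma deltaE k x : xorw (delta k) x k = ~~ x k.
Proof. by rewrite /xorw /delta eqxx. Qed.

Lemma delta_neq k x i : i != k -> xorw (delta k) x i = x i.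
Proof. by rewrite /xorw /delta => /negbTE->. Qed.

Lemma delta_agree k x : agree k x (xorw (delta k) x).
Proof. by move=> i ltik; rewrite delta_neq ?ltn_eqF. Qed.

Lemma weight_agree k x y : agree k x y -> weight x k = weight y k.
Proof.
elim: k => //= k IHk xy; rewrite xy // IHk //.
exact: agree_le xy.
Qed.

Lemma weight_xorw_delta j k x : j < k -> x j = false ->
  weight (xorw (delta j) x) k = (weight x k).+1.
Proof.
move=> + xj; elim: k => //= k IHk; rewrite ltnS leq_eqVlt => /orP[/eqP<-|ltjk].
  by rewrite deltaE xj addn1 addn0 -(weight_agree (@delta_agree j x)).
by rewrite IHk // delta_neq ?gtn_eqF.
Qed.

(** Independence for the graph [A_S]; with [predT] for [S], all flips count as edges. *)
Definition indep (S : nat -> bool) (D : set (nat -> bool)) :=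
  forall x k, D x -> x k = false -> S (weight x k) -> ~ D (xorw (delta k) x).

(** * Borel and analytic subsets of the Cantor space *)

Inductive borelc : set (nat -> bool) -> Prop :=
| borelc_bit n : borelc [set x : nat -> bool | x n]
| borelc_setC D : borelc D -> borelc (~` D)
| borelc_bigcup (F : nat -> set (nat -> bool)) :
    (forall i, borelc (F i)) -> borelc (\bigcup_i F i).

Lemma borelc_bigcap (F : nat -> set (nat -> bool)) :
  (forall i, borelc (F i)) -> borelc (\bigcap_i F i).
Proof.
by move=> bF; rewrite -[X in borelc X]setCK setC_bigcap; apply/borelc_setC/borelc_bigcup => i;
  apply: borelc_setC.
Qed.

Lemma borelc_setU A B : borelc A -> borelc B -> borelc (A `|` B).
Proof.
move=> bA bB; rewrite (_ : _ `|` _ = \bigcup_i (if i is 0 then A else B)).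
  by apply: borelc_bigcup => -[].
apply/seteqP; split=> [x [Ax|Bx]|x [[|i] _]]; [by exists 0|by exists 1|by left|by right].
Qed.

Lemma borelc_setI A B : borelc A -> borelc B -> borelc (A `&` B).
Proof.
move=> bA bB; rewrite -[X in borelc X]setCK setCI.
by apply/borelc_setC/borelc_setU; apply: borelc_setC.
Qed.

Lemma borelc_setT : borelc setT.
Proof.
rewrite (_ : setT = [set x : nat -> bool | x 0] `|` ~` [set x | x 0]).
  by apply: borelc_setU; [|apply: borelc_setC]; apply: borelc_bit.
by rewrite setUv.
Qed.

Lemma borelc_set0 : borelc set0.
Proof. by rewrite -setCT; apply/borelc_setC/borelc_setT. Qed.

Lemma borelc_preimage_xorw m D : borelc D -> borelc (xorw m @^-1` D).
Proof.
elim=> {D} [n|D _ IHD|F _ IHF].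
- have [mn|mn] := boolP (m n); last first.
    by rewrite /preimage /xorw /= (negbTE mn); apply: borelc_bit.
  rewrite (_ : xorw m @^-1` [set x : nat -> bool | x n] = ~` [set x : nat -> bool | x n]).
    exact/borelc_setC/borelc_bit.
  by apply/seteqP; split=> x; rewrite /preimage /= /xorw mn /= => /negP.
- by rewrite -preimage_setC; apply: borelc_setC.
- by rewrite preimage_bigcup; apply: borelc_bigcup.
Qed.

(** By induction on [n]: once bit [n] is fixed, membership depends on the first [n] bits. *)
Lemma borelc_clopen n D : (forall x y, agree n x y -> D x -> D y) -> borelc D.
Proof.
elim: n D => [|n IHn] D Dn.
  have [[x Dx]|nD] := pselect (exists x, D x).
    rewrite (_ : D = setT); first exact: borelc_setT.
    by apply/seteqP; split=> // y _; apply: Dn Dx.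
  rewrite (_ : D = set0); first exact: borelc_set0.
  by apply/seteqP; split=> // x Dx; apply: nD; exists x.
have bU b : borelc [set x | D (update x n b)].
  apply: IHn => x y xy; apply: Dn => i; rewrite ltnS leq_eqVlt /update => /orP[/eqP->|ltin].
    by rewrite eqxx.
  by rewrite ltn_eqF ?xy.
have updx (x : nat -> bool) b : x n = b -> update x n b = x.
  by move=> <-; apply/funext => i; rewrite /update; case: eqP => // ->.
rewrite (_ : D = [set x : nat -> bool | x n] `&` [set x | D (update x n true)] `|`
  ~` [set x : nat -> bool | x n] `&` [set x | D (update x n false)]); last first.
  apply/seteqP; split=> x /=.
    by move=> Dx; case xn: (x n); [left|right]; rewrite updx.
  by case xn: (x n) => -[] []//; rewrite updx.
by apply: borelc_setU; apply: borelc_setI => //; [|apply: borelc_setC]; apply: borelc_bit.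
Qed.

(** * Closed relations between the Baire and Cantor spaces, and their projections *)

Definition closedrel (K : (nat -> nat) -> (nat -> bool) -> Prop) :=
  forall z x, (forall n, exists z' x', [/\ K z' x', agree n z z' & agree n x x']) ->
    K z x.

Lemma closedrel_and K K' : closedrel K -> closedrel K' ->
  closedrel (fun z x => K z x /\ K' z x).
Proof.
by move=> cK cK' z x zx; split; [apply: cK|apply: cK'] => n;
  have [z' [x' [[]]]] := zx n; exists z', x'.
Qed.

Lemma closedrel_comp K f g : closedrel K -> seq_continuous f -> seq_continuous g ->
  closedrel (fun z x => K (f z) (g x)).
Proof.
move=> cK fc gc z x zx; apply: cK => n.
have [m mP] := fc z n; have [p pP] := gc x n.
have [z' [x' [Kzx zz' xx']]] := zx (maxn m p).
exists (f z'), (g x'); split=> //; [apply: mP|apply: pP].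
  by apply: agree_le zz'; apply: leq_maxl.
by apply: agree_le xx'; apply: leq_maxr.
Qed.

Lemma closedrel_clopen n (Q : (nat -> nat) -> (nat -> bool) -> Prop) :
  (forall z z' x x', agree n z z' -> agree n x x' -> Q z x -> Q z' x') ->
  closedrel Q.
Proof.
move=> Qn z x /(_ n)[z' [x' [Qzx zz' xx']]].
by apply: Qn Qzx; apply: agree_sym.
Qed.

Lemma closedrel_graph u : seq_continuous u -> closedrel (fun z x => u z = x).
Proof.
move=> uc z x zx; apply: agree_all => n.
have [m mP] := uc z n; have [z' [x' [<- zz' xx']]] := zx (maxn m n).
apply: (@agree_trans _ _ (u z')); first by apply: mP; apply: agree_le zz'; apply: leq_maxl.
by apply: agree_sym; apply: agree_le xx'; apply: leq_maxr.
Qed.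

Definition analytic (D : set (nat -> bool)) :=
  exists2 K, closedrel K & forall x, D x <-> exists z, K z x.

(** These maps identify pairs of sequences with sequences, so that one witness can carry two. *)
Definition evens (T : Type) (z : nat -> T) : nat -> T := fun i => z i.*2.
Definition odds (T : Type) (z : nat -> T) : nat -> T := fun i => z i.*2.+1.
Definition interleave (T : Type) (a b : nat -> T) : nat -> T :=
  fun i => if odd i then b i./2 else a i./2.

Lemma evens_interleave T (a b : nat -> T) : evens (interleave a b) = a.
Proof. by apply/funext => i; rewrite /evens /interleave odd_double doubleK. Qed.

Lemma odds_interleave T (a b : nat -> T) : odds (interleave a b) = b.
Proof. by apply/funext => i; rewrite /odds /interleave /= odd_double uphalf_double. Qed.

Lemma evens_agree T n (y z : nat -> T) : agree n.*2 y z -> agree n (evens y) (evens z).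
Proof. by move=> yz i ltin; apply: yz; rewrite ltn_double. Qed.

Lemma odds_agree T n (y z : nat -> T) : agree n.*2 y z -> agree n (odds y) (odds z).
Proof. by move=> yz i ltin; apply: yz; rewrite ltn_Sdouble. Qed.

Lemma evens_seq_continuous T : seq_continuous (@evens T).
Proof. by move=> x n; exists n.*2 => y; apply: evens_agree. Qed.

Lemma odds_seq_continuous T : seq_continuous (@odds T).
Proof. by move=> x n; exists n.*2 => y; apply: odds_agree. Qed.

Lemma seq_continuous_id T : seq_continuous (@id (nat -> T)).
Proof. by move=> x n; exists n. Qed.

Lemma analytic_setI A B : analytic A -> analytic B -> analytic (A `&` B).
Proof.
move=> [K cK AK] [L cL BL]; exists (fun z x => K (evens z) x /\ L (odds z) x).
  apply: closedrel_and.
    exact: (closedrel_comp cK (@evens_seq_continuous _) (@seq_continuous_id _)).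
  exact: (closedrel_comp cL (@odds_seq_continuous _) (@seq_continuous_id _)).
move=> x; split=> [[/AK[a Ka] /BL[b Lb]]|[z [Kz Lz]]].
  by exists (interleave a b); rewrite evens_interleave odds_interleave.
by split; [apply/AK; exists (evens z)|apply/BL; exists (odds z)].
Qed.

Lemma analytic_xorw m D : analytic D -> analytic (xorw m @^-1` D).
Proof.
move=> [K cK DK]; exists (fun z x => K z (xorw m x)); last by move=> x; apply: DK.
exact: (closedrel_comp cK (@seq_continuous_id _) (@xorw_seq_continuous m)).
Qed.

Lemma bounded_lt (f : nat -> nat) n : exists N, forall b, b < n -> f b < N.
Proof.
elim: n => [|n [N NP]]; first by exists 0.
exists (maxn N (f n).+1) => b; rewrite ltnS leq_eqVlt leq_max => /orP[/eqP->|/NP->//].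
by rewrite ltnSn orbT.
Qed.

Definition join (w : nat -> (nat -> bool) -> nat -> nat) x j : nat :=
  if @pickle_inv (nat * nat)%type j is Some p then w p.1 x p.2 else 0.

Lemma joinE w x p : join w x (pickle p) = w p.1 x p.2.
Proof. by rewrite /join pickleK_inv. Qed.

Lemma closedrel_join w : (forall i, closedrel (fun z x => w i x = z)) ->
  closedrel (fun z x => join w x = z).
Proof.
move=> wc z x zx.
have wxE a : w a x = fun b => z (pickle (a, b)).
  apply: (wc a) => n; have [N NP] := bounded_lt (fun b => pickle (a, b)) n.
  have [z' [x' [<- zz' xx']]] := zx (maxn N n).
  exists (w a x'), x'; split=> //; last by apply: agree_le xx'; apply: leq_maxr.
  move=> b ltbn; rewrite zz' ?joinE //.
  by rewrite (leq_trans _ (leq_maxl _ _)) // NP.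
apply/funext => j; rewrite /join; case uj: (pickle_inv j) => [[a b]|].
  by rewrite wxE; have := @pickle_invK (nat * nat)%type j; rewrite uj /= => ->.
have [z' [x' [<- zz' _]]] := zx j.+1.
by rewrite zz' // /join uj.
Qed.

(* The graph of [w] being closed, pulling back the topology along [x |-> (x, w x)]
   keeps it Polish and makes [D] clopen. *)
Lemma borelc_graph D : borelc D -> exists2 w : (nat -> bool) -> nat -> nat,
  closedrel (fun z x => w x = z) & forall x, D x <-> 0 < w x 0.
Proof.
elim=> {D} [n|D _ [w wc wD]|F _ IHF].
- exists (fun x i => x n : nat); last by move=> x /=; rewrite lt0b.
  move=> z x zx; apply: agree_all => m.
  have [z' [x' [<- zz' xx']]] := zx (maxn m n.+1).
  move=> i ltim; rewrite zz' ?xx' ?leq_max ?ltim ?ltnSn ?orbT//.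
(* The truth value for the complement is put in front of the old witness. *)
- exists (fun x i => if i is j.+1 then w x j else (w x 0 == 0) : nat); last first.
    move=> x /=; rewrite lt0b; split=> [nDx|/eqP w0 /wD]; last by rewrite w0.
    by rewrite eqn0Ngt; apply/negP => /wD.
  move=> z x zx.
  have wxE : w x = fun j => z j.+1.
    apply: wc => n; have [z' [x' [<- zz' xx']]] := zx n.+1.
    exists (w x'), x'; split=> //; last exact: agree_le xx'.
    by move=> i ltin; rewrite zz'.
  apply/funext => -[|j]; last by rewrite wxE.
  have [z' [x' [z'E zz' _]]] := zx 2.
  by rewrite wxE zz' // zz' // -z'E.
- have /choice[w wP] : forall i, exists w, closedrel (fun z x => w x = z) /\
      forall x, F i x <-> 0 < w x 0 by move=> i; have [w] := IHF i; exists w.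
  have wc := closedrel_join (fun i => (wP i).1).
  (* One more than the least index of a member containing [x], and 0 outside the union; it is stored
     in front of [join w x]. *)
  pose m x := if pselect (exists i, 0 < w i x 0) is left e then (ex_minn e).+1 else 0.
  exists (fun x i => if i is j.+1 then join w x j else m x); last first.
    move=> x /=; rewrite /m; case: pselect => [e|ne] /=; split=> //.
      by move=> _; case: e => i wi; exists i => //; apply/(wP i).2.
    by move=> [i _ /(wP i).2 wi]; case: ne; exists i.
  move=> z x zx.
  have wxE : join w x = fun j => z j.+1.
    apply: wc => n; have [z' [x' [<- zz' xx']]] := zx n.+1.
    exists (join w x'), x'; split=> //; last exact: agree_le xx'.
    by move=> i ltin; rewrite zz'.
  have wz a : w a x 0 = z (pickle (a, 0)).+1.
    by rewrite -[LHS](joinE w x (a, 0)) wxE.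
  (* If [z 0] is positive, an approximant that agrees with [z] on the codes of [(b, 0)] for
     [b <= z 0] has the same least index as [x]. If [z 0] is 0, an index [i] that works for [x]
     would also work for an approximant agreeing past the code of [(i, 0)]. *)
  have m_lim : m x = z 0.
    have [N NP] := bounded_lt (fun b => pickle (b, 0)) (z 0).+1.
    have [z' [x' [z'E zz' xx']]] := zx N.+1.
    have z0 : z 0 = m x' by rewrite zz' // -z'E.
    have wE b : b <= z 0 -> w b x 0 = w b x' 0.
      by move=> bz; rewrite wz zz' ?ltnS ?NP // -z'E joinE.
    move: z0; rewrite [m x']/m; case: pselect => [e|ne] z0.
      case: ex_minnP z0 => i wi imin z0.
      rewrite /m; case: pselect => [e'|]; last first.
        by move=> ne; exfalso; apply: ne; exists i; rewrite wE // z0.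
      case: ex_minnP => j wj jmin; rewrite z0; congr _.+1.
      have ji : j <= i by apply: jmin; rewrite wE // z0.
      by apply/eqP; rewrite eqn_leq ji imin // -wE // z0 leqW.
    rewrite z0 /m; case: pselect => // -[i wi]; case: ne.
    have [z'' [x'' [z''E zz'' _]]] := zx (pickle (i, 0)).+2.
    move: wi; rewrite wz zz'' // -z''E joinE => wi.
    have : z 0 = m x'' by rewrite zz'' // -z''E.
    by rewrite z0 /m; case: pselect => // -[]; exists i.
  by apply/funext => -[|j]; [exact: m_lim|rewrite wxE].
Qed.

Lemma analytic_borelc D : borelc D -> analytic D.
Proof.
move=> /borelc_graph[w wc wD]; exists (fun z x => w x = z /\ 0 < z 0).
  apply: closedrel_and => //; apply: (@closedrel_clopen 1) => z z' x x' zz' _.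
  by rewrite zz'.
by move=> x; split=> [/wD wx|[z [<- /wD]]//]; exists (w x).
Qed.

(** * Lusin separation *)

Definition borelc_separated (A B : set (nat -> bool)) :=
  exists W, [/\ borelc W, A `<=` W & W `&` B = set0].

Lemma borelc_separated_bigcup (A B : nat -> set (nat -> bool))
    (X Y : set (nat -> bool)) :
  X `<=` \bigcup_i A i -> Y `<=` \bigcup_i B i ->
  (forall i j, borelc_separated (A i) (B j)) -> borelc_separated X Y.
Proof.
move=> XA YB /(_ _)/choice AB.
have /choice[W WP] : forall i, exists W, forall j,
    [/\ borelc (W j), A i `<=` W j & W j `&` B j = set0].
  by move=> i; have [W] := AB i; exists W.
exists (\bigcup_i \bigcap_j W i j); split.
- by apply: borelc_bigcup => i; apply: borelc_bigcap => j; have [] := WP i j.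
- by move=> x /XA[i _ Ax]; exists i => // j _; have [_ + _] := WP i j; apply.
- rewrite -subset0 => x [[i _ Wx] /YB[j _ Bx]].
  by have [_ _ <-] := WP i j; split=> //; apply: Wx.
Qed.

(** If no Borel set separates, longer and longer prefixes of points and witnesses can be chosen
    whose pieces stay inseparable. In the limit the two points coincide and both relations hold by
    closedness, so the sets meet. *)
Lemma lusin_separation D1 D2 : analytic D1 -> analytic D2 ->
  D1 `&` D2 = set0 -> borelc_separated D1 D2.
Proof.
move=> [K1 cK1 DK1] [K2 cK2 DK2] D12; apply: contrapT => nsep.
pose piece K n (s : (nat -> nat) * (nat -> bool)) : set (nat -> bool) :=
  [set x | agree n s.2 x /\ exists2 z, agree n s.1 z & K z x].
pose ext n (s : (nat -> nat) * (nat -> bool)) i := (update s.1 n i./2, update s.2 n (odd i)).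
have piece_ext K n s : piece K n s `<=` \bigcup_i piece K n.+1 (ext n s i).
  move=> x [sx [z sz Kz]]; exists (x n + (z n).*2) => //.
  rewrite /piece /= half_bit_double oddD odd_double addbF oddb.
  by split; [|exists z => //]; apply: agree_update.
pose T := (((nat -> nat) * (nat -> bool)) * ((nat -> nat) * (nat -> bool)))%type.
have [] := @dep_choice T
  (fun n st => ~ borelc_separated (piece K1 n st.1) (piece K2 n st.2))
  (fun n st st' => [/\ agree n st.1.1 st'.1.1, agree n st.1.2 st'.1.2,
     agree n st.2.1 st'.2.1 & agree n st.2.2 st'.2.2])
  (((fun=> 0), (fun=> false)), ((fun=> 0), (fun=> false))).
- move=> [W [bW sW Wd]]; apply: nsep; exists W; split=> //.
    by move=> x /DK1[z Kz]; apply: sW; split=> //; exists z.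
  rewrite -subset0 => x [Wx /DK2[z Kz]]; rewrite -Wd; split=> //.
  by split=> //; exists z.
- move=> n [s t] /= nst.
  have [i [j nij]] : exists i j,
      ~ borelc_separated (piece K1 n.+1 (ext n s i)) (piece K2 n.+1 (ext n t j)).
    apply: contrapT => nij; apply: nst.
    apply: borelc_separated_bigcup (piece_ext K1 n s) (piece_ext K2 n t) _ => // i j.
    by apply: contrapT => nsij; apply: nij; exists i, j.
  by exists (ext n s i, ext n t j); split=> //; split; apply: update_agree.
move=> st [_ stP].
have [z1 z1P] : exists z, forall n, agree n z (st n).1.1.
  by apply: agree_lim => n; have [_ []] := stP n.
have [x1 x1P] : exists z, forall n, agree n z (st n).1.2.
  by apply: agree_lim => n; have [_ []] := stP n.
have [z2 z2P] : exists z, forall n, agree n z (st n).2.1.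
  by apply: agree_lim => n; have [_ []] := stP n.
have [x2 x2P] : exists z, forall n, agree n z (st n).2.2.
  by apply: agree_lim => n; have [_ []] := stP n.
(* If the limits differ at [i], the value of bit [i] separates the pieces of length [i.+1]. *)
have x12 : x1 = x2.
  apply/funext => i; apply: contrapT => xi; have [+ _] := stP i.+1; apply.
  exists [set x | x i = x1 i]; split.
  - by apply: (@borelc_clopen i.+1) => x y xy <-; rewrite xy.
  - by move=> x [xx _]; rewrite /= -xx // -x1P.
  - rewrite -subset0 => x /= [xx [xx' _]]; apply: xi.
    by rewrite -xx -xx' // -x2P.
(* Otherwise some piece of [K1] is empty, and the empty set separates it; dually, the full set does
   for [K2]. *)
have Kz1 : K1 z1 x1.
  apply: cK1 => n; apply: contrapT => nK; have [+ _] := stP n; apply.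
  exists set0; split; [exact: borelc_set0| |by rewrite set0I].
  move=> x [xx [z zz Kz]]; apply: nK; exists z, x; split=> //.
    exact: agree_trans (z1P n) zz.
  exact: agree_trans (x1P n) xx.
have Kz2 : K2 z2 x2.
  apply: cK2 => n; apply: contrapT => nK; have [+ _] := stP n; apply.
  exists setT; split; [exact: borelc_setT|by []|].
  rewrite setTI -subset0 => x [xx [z zz Kz]]; apply: nK; exists z, x; split=> //.
    exact: agree_trans (z2P n) zz.
  exact: agree_trans (x2P n) xx.
suff : (D1 `&` D2) x1 by rewrite D12.
by split; [apply/DK1; exists z1|apply/DK2; exists z2; rewrite x12].
Qed.

(** For each [k], [D] is disjoint from the flips at [k] of its points where such a flip is an edge;
    both sets are analytic, and a Borel [W k] separates them. Deleting from the intersection [D1] of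
    the [W k] the lower ends of all edges inside [D1] leaves an independent set, and no point of [D]
    is deleted. *)
Lemma indep_borelc_hull S D : analytic D -> indep S D ->
  exists W, [/\ borelc W, indep S W & D `<=` W].
Proof.
move=> aD iD.
pose X k : set (nat -> bool) := [set x | x k = false /\ S (weight x k)].
have bX k : borelc (X k).
  apply: (@borelc_clopen k.+1) => x y xy; rewrite /X /= xy //.
  by rewrite (@weight_agree k x y) //; apply: agree_le xy.
have /choice[W WP] : forall k, exists W,
    [/\ borelc W, D `<=` W & W `&` (xorw (delta k) @^-1` (D `&` X k)) = set0].
  move=> k; apply: lusin_separation => //.
    by apply: analytic_xorw; apply: analytic_setI => //; apply: analytic_borelc.
  rewrite -subset0 => x [Dx [Dx' [xk Sx]]].
  by apply: (iD _ _ Dx' xk Sx); rewrite xorwK.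
pose D1 := \bigcap_k W k.
have bD1 : borelc D1 by apply: borelc_bigcap => k; have [] := WP k.
have DD1 : D `<=` D1 by move=> x Dx k _; have [_ + _] := WP k; apply.
exists (D1 `&` \bigcap_k ~` (X k `&` xorw (delta k) @^-1` D1)); split.
- apply: borelc_setI => //; apply: borelc_bigcap => k; apply/borelc_setC/borelc_setI => //.
  exact: borelc_preimage_xorw.
- move=> x k [D1x nx] xk Sx [D1x' _]; apply: (nx k) => //.
- move=> x Dx; split; first exact: DD1.
  move=> k _ [[xk Sx] D1x]; have [_ _ Wd] := WP k.
  suff : (W k `&` (xorw (delta k) @^-1` (D `&` X k))) (xorw (delta k) x) by rewrite Wd.
  by split; [apply: D1x|rewrite /preimage /= xorwK].
Qed.

(** * The ideal of small sets *)

(** The sigma-ideal generated by the independent Borel sets. All weights count as edges here, and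
    this makes the ideal invariant under masks, which change weights. *)
Definition small (D : set (nat -> bool)) := exists F : nat -> set (nat -> bool),
  (forall i, borelc (F i) /\ indep predT (F i)) /\ D `<=` \bigcup_i F i.

Lemma small_sub A B : A `<=` B -> small B -> small A.
Proof. by move=> AB [F [FP BF]]; exists F; split=> //; apply: subset_trans BF. Qed.

Lemma small_borelc D : borelc D -> indep predT D -> small D.
Proof. by move=> bD iD; exists (fun=> D); split=> // x Dx; exists 0. Qed.

Lemma small_bigcup (I : countType) (D : set (nat -> bool)) (F : I -> set (nat -> bool)) :
  D `<=` \bigcup_i F i -> (forall i, small (F i)) -> small D.
Proof.
move=> DF sF; have /choice[G GP] := sF.
exists (fun n => if @unpickle (I * nat)%type n is Some (i, j) then G i j else set0).
split=> [n|x /DF[i _ Fx]].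
  case: unpickle => [[i j]|]; first by have [+ _] := GP i; apply.
  by split; [exact: borelc_set0|].
have [_ /(_ _ Fx)[j _ Gx]] := GP i.
by exists (pickle (i, j)) => //; rewrite pickleK.
Qed.

(** A mask carries pairs that differ at bit [k] to such pairs, exchanging the two ends when [m k]
    holds. *)
Lemma small_xorw m D : small (xorw m @^-1` D) -> small D.
Proof.
move=> [F [FP DF]]; exists (fun i => xorw m @^-1` F i); split=> [i|x Dx].
  have [bF iF] := FP i; split; first exact: borelc_preimage_xorw.
  move=> x k Fx xk _; rewrite /preimage /= xorwCA => Fx'.
  have [mk|mk] := boolP (m k); last first.
    by apply: (iF _ k Fx) => //; rewrite /xorw (negbTE mk).
  by apply: (iF _ k Fx'); rewrite ?deltaE ?xorwK // /xorw mk xk.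
have : (xorw m @^-1` D) (xorw m x) by rewrite /preimage /= xorwK.
by move=> /DF[i _ Fx]; exists i.
Qed.

Lemma small_analytic D : analytic D -> indep predT D -> small D.
Proof.
move=> aD /(indep_borelc_hull aD)[W [bW iW DW]].
by apply: small_sub DW _; apply: small_borelc.
Qed.

Lemma analytic_edge D k : analytic D ->
  analytic [set x | [/\ D x, x k = false & D (xorw (delta k) x)]].
Proof.
move=> aD; rewrite (_ : mkset _ =
    D `&` [set x | x k = false] `&` (xorw (delta k) @^-1` D)); last first.
  by apply/seteqP; split=> x /= [] // [].
apply: analytic_setI; last exact: analytic_xorw.
apply: analytic_setI => //; apply: analytic_borelc.
by apply: (@borelc_clopen k.+1) => x y xy /=; rewrite xy.
Qed.

(** Otherwise the lower ends of the edges at positions from [K] on lie in a small Borel set [M]. The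
    rest of [D], sorted by its first [K] bits, splits into independent analytic sets: an edge inside
    one class has position at least [K], so its lower end is in [M]. *)
Lemma not_small_edge D K : analytic D -> ~ small D ->
  exists2 k, K <= k & ~ small [set x | [/\ D x, x k = false & D (xorw (delta k) x)]].
Proof.
move=> aD nD; apply: contrapT => nk; apply: nD.
have /choice[N NP] : forall k, exists N : nat -> set (nat -> bool), K <= k ->
    (forall i, borelc (N i) /\ indep predT (N i)) /\
    [set x | [/\ D x, x k = false & D (xorw (delta k) x)]] `<=` \bigcup_i N i.
  move=> k; have [Kk|_] := boolP (K <= k); last by exists (fun=> set0).
  have : small [set x | [/\ D x, x k = false & D (xorw (delta k) x)]].
    by apply: contrapT => nsk; apply: nk; exists k.
  by move=> [N NP]; exists N.
pose M := \bigcup_k \bigcup_i N (K + k) i.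
have bM : borelc M.
  apply: borelc_bigcup => k; apply: borelc_bigcup => i.
  by have [/(_ i)[]] := NP (K + k) (leq_addr _ _).
pose F (t : seq bool + (nat * nat)) : set (nat -> bool) := match t with
  | inl t => D `&` ~` M `&` [set x | mkseq x K = t]
  | inr (k, i) => N (K + k) i end.
apply: (@small_bigcup _ _ F) => [x Dx|[t|[k i]]] /=; last first.
- by have [/(_ i)[? ?] _] := NP (K + k) (leq_addr _ _); apply: small_borelc.
- apply: small_analytic.
    apply: analytic_setI; last first.
      apply: analytic_borelc; apply: (@borelc_clopen K) => x y xy /= <-.
      apply: (@eq_from_nth _ false); rewrite !size_mkseq // => i iK.
      by rewrite !nth_mkseq // xy.
    by apply: analytic_setI => //; apply/analytic_borelc/borelc_setC.
  move=> x k [[Dx Mx] xt] xk _ [[Dx' _] xt'].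
  have Kk : K <= k.
    rewrite leqNgt; apply/negP => kK.
    have : nth false (mkseq x K) k = nth false (mkseq (xorw (delta k) x) K) k.
      by rewrite xt xt'.
    by rewrite !nth_mkseq // deltaE; case: (x k).
  apply: Mx; exists (k - K) => //; have [_] := NP _ Kk.
  by rewrite subnKC //; apply.
- have [[k _ [i _ Nx]]|nMx] := pselect (M x); first by exists (inr (k, i)).
  by exists (inl (mkseq x K)).
Qed.

(* The masks [u] flip [j] of the first [m] positions of a cube of dimension [m] + 1
   whose last position is [k]. *)
Lemma not_small_cube D m K : analytic D -> ~ small D ->
  exists k D', [/\ K <= k, ~ small D', (forall x, D' x -> x k = false) &
    forall j, j <= m -> exists2 u, u k = false &
      forall x, D' x -> [/\ D (xorw u x), D (xorw u (xorw (delta k) x)) &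
        weight (xorw u x) k = weight x k + j]].
Proof.
elim: m K D => [|m IHm] K D aD nD.
  have [k Kk nk] := not_small_edge K aD nD.
  exists k; eexists; split; [exact: Kk|exact: nk|by move=> x []|].
  move=> j; rewrite leqn0 => /eqP->; exists (fun=> false) => // x [Dx xk Dx'].
  by rewrite !xorw0 addn0.
have [k1 Kk1 nk1] := not_small_edge K aD nD.
have [k [D' [k1k nD' D'k D'P]]] := IHm k1.+1 _ (analytic_edge k1 aD) nk1.
exists k, D'; split=> //; first by rewrite (leq_trans Kk1) // ltnW.
move=> j; rewrite leq_eqVlt => /orP[/eqP->|ltjm]; last first.
  have [u uk uP] := D'P j ltjm; exists u => // x /uP[[? _ _] [? _ _]] ?; split=> //.
(* Flips over the smaller cube give the values up to [m]; the value [m.+1] comes from its full mask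
   together with the first edge [k1], which lies before [k]. *)
have [u uk uP] := D'P m (leqnn m); exists (xorw (delta k1) u).
  by rewrite delta_neq // gtn_eqF.
move=> x /uP[[Dx xk1 Dx1] [_ _ Dx2] wx].
rewrite -!xorwA; split=> //.
by rewrite weight_xorw_delta // wx addnS.
Qed.

(** The base points of an [m]-cube are sorted by their weight [c] at the last position. In each
    class, the mask that adds [j] ones with [S (c + j)] leads into the required edge set, and masks
    preserve smallness. *)
Lemma not_small_edge_weight (S : pred nat) m D K :
  (forall c, exists2 j, j <= m & S (c + j)) ->
  analytic D -> ~ small D ->
  exists2 k, K <= k & ~ small [set x |
    [/\ D x, x k = false, S (weight x k) & D (xorw (delta k) x)]].
Proof.
move=> Sm aD nD; have [k [D' [Kk nD' D'k D'P]]] := not_small_cube m K aD nD.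
exists k => // sk; apply: nD'.
apply: (@small_bigcup _ _ (fun c => D' `&` [set x | weight x k = c])).
  by move=> x D'x; exists (weight x k).
move=> c; have [j jm Scj] := Sm c; have [u uk uP] := D'P j jm.
apply/(@small_xorw u)/small_sub/sk => y; rewrite /preimage /= => -[/[dup] D'x /uP].
rewrite !xorwK xorwCA xorwK => -[Dy Dy' wy] yc; split=> //.
  by have := D'k _ D'x; rewrite /xorw uk.
by rewrite wy yc.
Qed.

(** * Baire category *)

Definition nowhere_dense (N : set (nat -> bool)) := forall x n, exists y m,
  [/\ n <= m, agree n x y & forall z, agree m y z -> ~ N z].

Definition meager (M : set (nat -> bool)) := exists N : nat -> set (nat -> bool),
  (forall i, nowhere_dense (N i)) /\ M `<=` \bigcup_i N i.

Lemma nowhere_dense_set0 : nowhere_dense set0.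
Proof. by move=> x n; exists x, n; split=> // z _ []. Qed.

Lemma meager_sub A B : A `<=` B -> meager B -> meager A.
Proof. by move=> AB [N [NP BN]]; exists N; split=> //; apply: subset_trans BN. Qed.

Lemma meager_bigcup (I : countType) (D : set (nat -> bool)) (F : I -> set (nat -> bool)) :
  D `<=` \bigcup_i F i -> (forall i, meager (F i)) -> meager D.
Proof.
move=> DF mF; have /choice[G GP] := mF.
exists (fun n => if @unpickle (I * nat)%type n is Some (i, j) then G i j else set0).
split=> [n|x /DF[i _ Fx]].
  case: unpickle => [[i j]|]; first by have [+ _] := GP i; apply.
  exact: nowhere_dense_set0.
have [_ /(_ _ Fx)[j _ Gx]] := GP i.
by exists (pickle (i, j)) => //; rewrite pickleK.
Qed.

Lemma meager_nowhere_dense N : nowhere_dense N -> meager N.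
Proof. by move=> nN; exists (fun=> N); split=> // x Nx; exists 0. Qed.

Lemma meager_xorw u M : meager M -> meager (xorw u @^-1` M).
Proof.
move=> [N [NP MN]]; exists (fun i => xorw u @^-1` N i); split=> [i x n|x /MN[i _ Nx]].
  have [y [m [nm xy yN]]] := NP i (xorw u x) n.
  exists (xorw u y), m; split=> //.
    by rewrite -[x](xorwK u); apply: xorw_agree.
  by move=> z yz; apply: yN; rewrite -[y](xorwK u); apply: xorw_agree.
by exists i.
Qed.

Lemma baire_category M x n : meager M -> exists2 y, agree n x y & ~ M y.
Proof.
move=> [N [NP MN]].
have [||f [f0 fP]] := @dep_choice ((nat -> bool) * nat)%type (fun i s => i <= s.2)
   (fun i s t => [/\ s.2 <= t.2, agree s.2 s.1 t.1 &
      forall z, agree t.2 t.1 z -> ~ N i z]) (x, n) => //.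
  (* Asking for length [m.+1] makes the lengths grow with [i], so that the centres converge. *)
  move=> i [y m] /= im; have [y' [m' [mm' yy' y'N]]] := NP i y m.+1.
  exists (y', m'); rewrite /= (leq_ltn_trans im) //; split=> //; split=> //; first exact: ltnW.
  exact: agree_le yy'.
have fmono i j : i <= j -> (f i).2 <= (f j).2 /\ agree (f i).2 (f i).1 (f j).1.
  move=> /subnK<-; elim: (j - i) => // d [IH1 IH2]; rewrite addSn.
  have [_ [le1 ag1 _]] := fP (d + i); split; first exact: leq_trans le1.
  by apply: agree_trans IH2 _; apply: agree_le ag1.
have [y yP] : exists y, forall i, agree i y (f i).1.
  by apply: agree_lim => i; have [fi [_ ag _]] := fP i; apply: agree_le ag.
have fy i : agree (f i).2 (f i).1 y.
  have [_ ag] := fmono i (maxn i (f i).2) (leq_maxl _ _).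
  apply: agree_trans ag _; apply: agree_sym.
  by apply: agree_le (yP _); apply: leq_maxr.
exists y; first by have := fy 0; rewrite f0.
move=> /MN[i _]; have [_ [_ _ h]] := fP i; apply: h; exact: fy.
Qed.

Definition box n (x : nat -> bool) : set (nat -> bool) := [set y | agree n x y].

(** There are only countably many boxes on which [D] is meager; the points of [box n x] outside all
    of them form a nowhere dense set, since such boxes are dense there. *)
Lemma meager_local D x n :
  (forall y m, n <= m -> agree n x y ->
     exists z p, [/\ m <= p, agree m y z & meager (D `&` box p z)]) ->
  meager (D `&` box n x).
Proof.
move=> Dloc.
pose w (t : seq bool) := nth false t.
pose F (o : option (seq bool)) : set (nat -> bool) := match o with
  | Some t => if pselect (meager (D `&` box (size t) (w t))) then D `&` box (size t) (w t) else set0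
  | None => [set y | agree n x y /\ forall z p, agree p z y -> ~ meager (D `&` box p z)] end.
apply: (@meager_bigcup _ _ F) => [y [Dy xy]|[t|]] /=.
- have [[z [p [zy mD]]]|nmD] := pselect (exists z p, agree p z y /\ meager (D `&` box p z)).
    have zt : box p z = box (size (mkseq z p)) (w (mkseq z p)).
      apply/seteqP; split=> u zu i ip.
        by rewrite size_mkseq in ip; rewrite /w nth_mkseq // zu.
      by have := zu i; rewrite size_mkseq /w nth_mkseq // => ->.
    exists (Some (mkseq z p)) => //=; case: pselect; rewrite -zt //.
  by exists None => //=; split=> // z p zy mD; apply: nmD; exists z, p.
- case: (pselect (meager (D `&` box (size t) (w t)))) => // nm.
  by apply: meager_nowhere_dense; apply: nowhere_dense_set0.
- apply: meager_nowhere_dense => y m.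
  have [xy|nxy] := pselect (agree n x y); last first.
    exists y, (maxn m n); split; [exact: leq_maxl|by []|].
    move=> z yz [xz _]; apply: nxy; apply: agree_trans xz _; apply: agree_sym.
    by apply: agree_le yz; apply: leq_maxr.
  have [z [p [mp yz Dz]]] := Dloc y (maxn m n) (leq_maxr _ _) xy.
  exists z, p; split=> //; first by rewrite (leq_trans _ mp) ?leq_maxl.
    by apply: agree_le yz; apply: leq_maxl.
  by move=> u zu [_ /(_ _ _ zu)].
Qed.

(** A form of the Baire property: inside every box there is a box on which [D] is meager or
    comeager. For a union, either some member is comeager on a smaller box, or every member is
    meager on densely many boxes and [meager_local] applies. *)
Lemma borelc_baire D : borelc D -> forall x n, exists y m, [/\ n <= m, agree n x y &
  meager (D `&` box m y) \/ meager (box m y `&` ~` D)].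
Proof.
elim=> {D} [k|D _ IHD|F _ IHF] x n.
- exists x, (maxn n k.+1); split; rewrite ?leq_maxl //.
  have xk y : box (maxn n k.+1) x y -> x k = y k.
    by apply; rewrite leq_max ltnSn orbT.
  have m0 := meager_nowhere_dense nowhere_dense_set0.
  case E: (x k); [right|left]; apply: meager_sub m0 => y [] /=.
    by move=> /xk; rewrite E => <-.
  by move=> + /xk; rewrite E => + ykf; rewrite -ykf.
- have [y [m [nm xy [mD|mD]]]] := IHD x n; exists y, m; split=> //; [right|left].
    by rewrite setCK setIC.
  by rewrite setIC.
- have [[i [y [m [nm xy mF]]]]|nF] := pselect (exists i y m, [/\ n <= m, agree n x y &
     meager (box m y `&` ~` F i)]).
    exists y, m; split=> //; right; apply: meager_sub mF => z [yz nFz]; split=> // Fz.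
    by apply: nFz; exists i.
  exists x, n; split=> //; left.
  apply: (@meager_bigcup _ _ (fun i => F i `&` box n x)).
    by move=> z [[i _ Fz] xz]; exists i.
  move=> i; apply: meager_local => y m nm xy.
  have [z [p [mp yz [|mF]]]] := IHF i y m; first by exists z, p.
  case: nF; exists i, z, p; split=> //; first exact: leq_trans mp.
  by apply: agree_trans xy _; apply: agree_le yz.
Qed.

(** One of the sets would be nonmeager, hence comeager in some box. A generic point of that box and
    its flip at a well-chosen position then both belong to it, against independence. *)
Lemma indep_not_cover (S : pred nat) (F : nat -> set (nat -> bool)) :
  (forall c, exists j, S (c + j)) ->
  (forall i, borelc (F i) /\ indep S (F i)) -> exists x, forall i, ~ F i x.
Proof.
move=> Sinf FP; apply: contrapT => nx.
have Fcov : setT `<=` \bigcup_i F i.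
  move=> x _; apply: contrapT => nFx; apply: nx; exists x => i Fx.
  by apply: nFx; exists i.
have [i nmF] : exists i, ~ meager (F i).
  apply: contrapT => nF.
  have [|y _ []//] := @baire_category setT (fun=> false) 0.
  apply: (meager_bigcup Fcov) => i; apply: contrapT => nFi.
  by apply: nF; exists i.
have [bF iF] := FP i.
have [x [n m_dense]] : exists x n, forall y m, n <= m -> agree n x y -> ~ meager (F i `&` box m y).
  apply: contrapT => nxn; apply: nmF.
  apply: (@meager_sub _ (F i `&` box 0 (fun=> false))) => //.
  apply: meager_local => y m _ _; apply: contrapT => nz.
  apply: nxn; exists y, m => z p mp yz mF; apply: nz; exists z, p; split=> //.
have [y [m [nm xy [|mF]]]] := borelc_baire bF x n; first by move/(m_dense y m nm xy).
have [j Sj] := Sinf (weight y m).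
(* The [j] ones placed after the prefix bring the weight at position [m + j] to a value satisfying
   [S], and the bit there is 0. *)
pose z : nat -> bool := fun i => if i < m then y i else i < m + j.
have yz : agree m y z by move=> l lm; rewrite /z lm.
have wz d : d <= j -> weight z (m + d) = weight y m + d.
  elim: d => [|d IHd] dj; first by rewrite !addn0 (weight_agree yz).
  rewrite addnS /= IHd ?(ltnW dj) // /z ltnNge leq_addr /= ltn_add2l dj.
  by rewrite addn1 addnS.
pose B := box m y `&` ~` F i.
have [|t zt nBt] := @baire_category (B `|` xorw (delta (m + j)) @^-1` B) z (m + j).+1.
  apply: (@meager_bigcup _ _ (fun b : bool => if b then B else xorw (delta (m + j)) @^-1` B)).
    by move=> u [Bu|Bu]; [exists true|exists false].
  by case=> //; apply: meager_xorw.
have yt : agree m y t.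
  by apply: agree_trans yz _; apply: agree_le zt; rewrite -addnS leq_addr.
have Ft : F i t by apply: contrapT => nFt; apply: nBt; left.
have Ft' : F i (xorw (delta (m + j)) t).
  apply: contrapT => nFt; apply: nBt; right; split=> //.
  apply: agree_trans yt _.
  by apply: (@agree_le _ _ (m + j)); rewrite ?leq_addr //; apply: delta_agree.
apply: (iF t (m + j)) Ft' => //.
  by rewrite -zt // /z ltnNge leq_addr /= ltnn.
rewrite -(@weight_agree _ z) ?wz //.
exact: agree_le zt.
Qed.

(** * Toeplitz words *)

Definition toep (x : nat -> bool) (n : nat) := x (logn 2 n.+1).

Lemma toep_even x n : toep x n.*2 = x 0.
Proof. by rewrite /toep lognE /= dvdn2 /= odd_double. Qed.

Lemma toep_odd x n : toep x n.*2.+1 = toep (fun i => x i.+1) n.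
Proof. by rewrite /toep -doubleS -muln2 lognM // lognE /= addn1. Qed.

(** Adding a multiple of [2 ^ n.+1] to a positive number below [2 ^ n.+1] preserves its 2-adic
    valuation; [j] leads from [c] to the next such multiple. *)
Lemma toep_recurrent x n : exists m, forall c, exists2 j, j <= m &
  forall i, i <= n -> toep x (c + j + i) = toep x i.
Proof.
have lt2 : n.+1 < 2 ^ n.+1 by apply: ltn_expl.
exists (2 ^ n.+1) => c; exists (2 ^ n.+1 - c %% 2 ^ n.+1); first exact: leq_subr.
move=> i i_n; rewrite /toep; congr x.
have -> : c + (2 ^ n.+1 - c %% 2 ^ n.+1) = (c %/ 2 ^ n.+1).+1 * 2 ^ n.+1.
  rewrite {1}(divn_eq c (2 ^ n.+1)) -addnA subnKC; last by rewrite ltnW // ltn_mod expn_gt0.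
  by rewrite mulSn addnC.
have i2 : i.+1 < 2 ^ n.+1 by apply: leq_ltn_trans lt2.
rewrite -addnS; set q := _.+1 * _.
have q2 : 2 ^ n.+1 %| q by apply: dvdn_mull.
have q0 : 0 < q + i.+1 by rewrite addnS.
apply/eqP; rewrite eqn_leq; apply/andP; split.
- rewrite -pfactor_dvdn //.
  have l1 : logn 2 (q + i.+1) <= n.+1.
    rewrite leqNgt; apply/negP => l2.
    have : 2 ^ n.+1 %| q + i.+1 by rewrite pfactor_dvdn // ltnW.
    by rewrite dvdn_addr // => /dvdn_leq-/(_ isT); rewrite leqNgt i2.
  have : 2 ^ logn 2 (q + i.+1) %| q + i.+1 by rewrite pfactor_dvdn.
  by rewrite dvdn_addr // (dvdn_trans _ q2) // dvdn_exp2l.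
- rewrite -pfactor_dvdn //; apply: dvdn_add; last by rewrite pfactor_dvdn.
  apply: dvdn_trans q2; apply: dvdn_exp2l.
  rewrite leqNgt; apply/negP => l2.
  have : 2 ^ n.+1 %| i.+1 by rewrite pfactor_dvdn // ltnW.
  by move=> /dvdn_leq-/(_ isT); rewrite leqNgt i2.
Qed.

(** The bound depends on [e] alone. It doubles at each step, because the odd positions of a Toeplitz
    word carry the Toeplitz word of the shifted sequence. *)
Lemma toep_hit e : exists B, forall x c, exists2 n, n <= B & toep x (c + n) = x e.
Proof.
elim: e => [|e [B IHe]].
  exists 1 => x c; exists (odd c); first by case: odd.
  by rewrite -{1}(odd_double_half c) addnAC addnn -doubleD toep_even.
exists B.*2.+1 => x c; have [n nB nE] := IHe (fun i => x i.+1) c./2.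
exists (n.*2 + ~~ odd c); first by rewrite -addn1 leq_add ?leq_double // leq_b1.
rewrite -nE -toep_odd doubleD -addSn -{1}(odd_double_half c); congr toep.
by case: odd; rewrite /= ?addn0 ?addn1 ?add0n ?add1n ?addnS ?addSn.
Qed.

Definition prefixes_occur (S S' : nat -> bool) :=
  forall n, exists c, forall i, i <= n -> S i = S' (c + i).

(** The even positions of [toep x] all carry [x 0]. In an occurrence at an odd place of [toep y]
    they would meet every letter of the shifted [y], among them the negation of [x 0]. So long
    prefixes occur at even places, and the two parity classes can be compared separately. *)
Lemma toep_prefixes_shift x y : (forall b, exists i, y i.+1 = b) ->
  prefixes_occur (toep x) (toep y) ->
  x 0 = y 0 /\ prefixes_occur (toep (fun i => x i.+1)) (toep (fun i => y i.+1)).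
Proof.
move=> yb xy; have [e ye] := yb (~~ x 0); have [B hB] := toep_hit e.
have even_occ n : exists c, forall i, i <= n -> toep x i = toep y (c.*2 + i).
  have [c cP] := xy (n + B.*2); have [oc|ec] := boolP (odd c); last first.
    exists c./2 => i i_n; rewrite cP; last by rewrite (leq_trans i_n) ?leq_addr.
    by rewrite -(odd_double_half c) (negbTE ec) add0n doubleK.
  have [m mB mE] := hB (fun i => y i.+1) c./2.
  have := cP m.*2; rewrite toep_even -(odd_double_half c) oc add1n addSn.
  rewrite -doubleD toep_odd mE ye => h.
  have : x 0 = ~~ x 0 by apply: h; rewrite (leq_trans _ (leq_addl _ _)) ?leq_double.
  by case: (x 0).
split.
  by have [c /(_ 0 isT)] := even_occ 0; rewrite addn0 toep_even (toep_even x 0).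
move=> n; have [c cP] := even_occ n.*2.+1; exists c => i i_n.
by rewrite -!toep_odd cP ?ltnS ?leq_double // doubleD addnS.
Qed.

Lemma toep_prefixes_eq x y : (forall b n, exists2 i, n <= i & y i = b) ->
  prefixes_occur (toep x) (toep y) -> x = y.
Proof.
move=> yb xy; apply/funext => i.
elim: i x y yb xy => [|i IHi] x y yb /toep_prefixes_shift[].
- by move=> b; have [[//|j] _ yj] := yb b 1; exists j.
- by [].
- by move=> b; have [[//|j] _ yj] := yb b 1; exists j.
move=> _ /(IHi (fun i => x i.+1) (fun i => y i.+1)); apply=> b n.
by have [[//|j] nj yj] := yb b n.+1; exists j.
Qed.

(* Both letters occur infinitely often in [spread a], and its first letter is 1. *)
Definition spread (a : nat -> bool) (n : nat) : bool :=
  if n is m.+1 then odd m (+) a m./2 else true.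

Lemma spread_inj : injective spread.
Proof.
move=> a b ab; apply/funext => i.
by have := congr1 (@^~ i.*2.+1) ab; rewrite /= odd_double doubleK.
Qed.

Lemma spread_onto a b n : exists2 i, n <= i & spread a i = b.
Proof.
exists (n.*2 + (b (+) a n)).+1.
  by rewrite leqW // -addnn -addnA leq_addr.
case E: (b (+) a n); rewrite /= ?addn1 ?addn0 /= odd_double ?uphalf_double ?doubleK.
  by case: b (a n) E => [] [].
by case: b (a n) E => [] [].
Qed.

(** * The graph [A_S] and its embeddings into itself *)

Definition flip_graph (S : nat -> bool) : set ((nat -> bool) * (nat -> bool)) :=
  [set p | exists k, [/\ p.1 k = false, S (weight p.1 k) & p.2 = xorw (delta k) p.1]].

Lemma weight_le x k : weight x k <= k.
Proof. by elim: k => //= k IHk; rewrite -addn1 leq_add // leq_b1. Qed.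

Lemma weight_range x y a b : a <= b -> (forall i, a <= i < b -> x i = y i) ->
  weight x b + weight y a = weight y b + weight x a.
Proof.
move=> /subnK<-; elim: (b - a) => [|d IHd] xy; first by rewrite addnC.
rewrite addSn /= xy; last by rewrite leq_addl ltnSn.
rewrite addnAC IHd; last by move=> i /andP[ai id]; rewrite xy // ai ltnW.
by rewrite addnAC.
Qed.

Section Embedding.
Variables (k : nat -> nat) (x : nat -> bool) (h : (nat -> bool) -> nat -> bool).
Hypotheses (kS : forall n, k n < k n.+1) (xk : forall n, x (k n) = false).
Hypotheses (hk : forall c n, h c (k n) = c n).
Hypothesis hx : forall c i, (forall n, k n <> i) -> h c i = x i.

Let k_lt : {mono k : m n / m < n}.
Proof. by apply: leqW_mono; apply: leq_mono; apply: homo_ltn ltn_trans kS. Qed.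

Let k_inj : injective k.
Proof. by apply: incn_inj; apply: leq_mono; apply: homo_ltn ltn_trans kS. Qed.

(** Here [h c] writes [c] at the positions [k n] of a background [x] that is 0 there, so the ones of
    the background and of [c] add up. *)
Lemma weight_embedding c n : weight (h c) (k n) = weight x (k n) + weight c n.
Proof.
elim: n => [|n IHn].
  have := @weight_range (h c) x 0 (k 0) (leq0n _); rewrite /= !addn0; apply.
  move=> i ik; apply: hx => n kn; move: ik.
  by rewrite -kn k_lt.
have := @weight_range (h c) x (k n).+1 (k n.+1) (kS n).
rewrite /= IHn hk xk addn0 => wE; apply/eqP; rewrite -(eqn_add2r (weight x (k n))).
rewrite wE => [|i /andP[ni iSn]]; last first.
  by apply: hx => m km; move: ni iSn; rewrite -km !k_lt ltnS => /leq_trans/[apply]; rewrite ltnn.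
by rewrite -!addnA eqn_add2l addnC -addnA.
Qed.

(** At position [k n] the word [c] contributes at most [n] ones, so the hypothesis on [S] only
    concerns [i <= n]. Conversely an edge between values of [h] must flip some [k n], the background
    being common. *)
Lemma flip_graph_embedding S c c' :
  (forall n i, i <= n -> S (weight x (k n) + i) = S i) ->
  flip_graph S (c, c') <-> flip_graph S (h c, h c').
Proof.
move=> SP; split=> [[n /= [cn Sn c'E]]|[l /= [cl Sl c'E]]].
  exists (k n); split=> /=; [by rewrite hk|by rewrite weight_embedding SP ?weight_le|].
  apply/funext => i; have [[m <-]|ni] := pselect (exists m, k m = i).
    by rewrite /xorw /delta hk c'E (inj_eq k_inj) hk.
  rewrite delta_neq; last by apply/eqP => ik; apply: ni; exists n.
  by rewrite !hx // => m km; apply: ni; exists m.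
have [[n kn]|nl] := pselect (exists n, k n = l); last first.
  have := congr1 (@^~ l) c'E; rewrite /= deltaE !hx.
  - by case: (x l).
  - by move=> m km; apply: nl; exists m.
  - by move=> m km; apply: nl; exists m.
subst l; exists n; split=> /=.
- by rewrite -(hk c).
- by rewrite -(SP n) ?weight_le // -weight_embedding.
- by apply/funext => i; rewrite -(hk c') c'E /xorw /delta (inj_eq k_inj) hk.
Qed.

End Embedding.

(** * Cantor schemes *)

(* A pair [(z, x)] in the [n]-th relation of the scheme codes [2 ^ n] pairs in [K0],
   one for each [c] in {0,1}^n: for [i] from [n - 1] down to 0, keep the odd or the
   even half of [z] according to [c i], and flip the [k i]-th bit of [x] if [c i]. *)
Section CantorScheme.
Variables (u v : (nat -> nat) -> nat -> bool) (S : nat -> bool).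
Hypotheses (uc : seq_continuous u) (vc : seq_continuous v).
Hypothesis Srec : forall n, exists m, forall c, exists2 j, j <= m &
  forall i, i <= n -> S (c + j + i) = S i.
Hypothesis not_small_range :
  ~ small [set x | (exists z, u z = x) /\ exists z, v z = x].

Let crel := (nat -> nat) -> (nat -> bool) -> Prop.

Let K0 : crel := fun z x => u (evens z) = x /\ v (odds z) = x.

Let proj (K : crel) : set (nat -> bool) := [set x | exists z, K z x].

Let good (K : crel) := closedrel K /\ ~ small (proj K).

(** The length [n.+1 * 2 ^ n.+1] is chosen so that [n.+1] common entries of the witness survive
    [n.+1] halvings. *)
Let refines n (s t : crel * nat) := [/\ s.2 < t.2,
  (forall z x, t.1 z x -> [/\ s.1 (evens z) x, s.1 (odds z) (xorw (delta t.2) x), x t.2 = false &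
    forall i, i <= n -> S (weight x t.2 + i) = S i]) &
  forall z x z' x', t.1 z x -> t.1 z' x' ->
    agree (n.+1 * 2 ^ n.+1) z z' /\ agree (n.+1 * 2 ^ n.+1) x x'].

Let mkseq_agree T n (x y : nat -> T) : mkseq x n = mkseq y n <-> agree n x y.
Proof.
split=> [xy i ltin|xy]; last first.
  apply: (@eq_from_nth _ (x 0)); rewrite !size_mkseq // => i ltin.
  by rewrite !nth_mkseq // xy.
by have := congr1 (fun s => nth (x 0) s i) xy; rewrite !nth_mkseq.
Qed.

Let good_K0 : good K0.
Proof.
split.
  apply: closedrel_and; apply: closedrel_graph.
    exact: (seq_continuous_comp uc (@evens_seq_continuous _)).
  exact: (seq_continuous_comp vc (@odds_seq_continuous _)).
move=> sK; apply: not_small_range; apply: small_sub sK => x [[a ua] [b vb]].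
by exists (interleave a b); rewrite /K0 evens_interleave odds_interleave.
Qed.

(** An edge is added at a position beyond the previous one where [S] looks like its initial segment;
    the two halves of the new witness are the witnesses of its ends. Sorting by prefixes of length
    [M] gives countably many classes, one of which is still not small. *)
Let refine n s : good s.1 -> exists t, good t.1 /\ refines n s t.
Proof.
case: s => K p [/= cK nK]; have [m mP] := Srec n.
pose T c := [forall i : 'I_n.+1, S (c + i) == S i].
have [c|||q pq nq] := @not_small_edge_weight T m (proj K) p.+1.
- have [j jm jP] := mP c; exists j => //; apply/forallP => i.
  by rewrite jP // -ltnS.
- by exists K.
- exact: nK.
pose M := n.+1 * 2 ^ n.+1.
pose L (ab : seq nat * seq bool) : crel := fun z x =>
  ((K (evens z) x /\ K (odds z) (xorw (delta q) x)) /\ (x q = false /\ T (weight x q))) /\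
  (mkseq z M = ab.1 /\ mkseq x M = ab.2).
have [ab nab] : exists ab, ~ small (proj (L ab)).
  apply: contrapT => nL; apply: nq.
  apply: (@small_bigcup _ _ (fun ab => proj (L ab))); last first.
    by move=> ab; apply: contrapT => nab; apply: nL; exists ab.
  move=> x [[z Kz] xq Tx [z' Kz']]; exists (mkseq (interleave z z') M, mkseq x M) => //.
  by exists (interleave z z'); rewrite /L evens_interleave odds_interleave.
exists (L ab, q); split; last first.
  split=> //= [z x [[[Kz Kz'] [xq /forallP Tx]] _]|z x z' x' [_ [zE xE]] [_ [zE' xE']]].
    by split=> // i; rewrite -ltnS => ltin; apply/eqP: (Tx (Ordinal ltin)).
  by split; apply/mkseq_agree; rewrite ?zE ?xE.
split=> //=; apply: closedrel_and; last first.
  apply: (@closedrel_clopen M) => z z' x x' /mkseq_agree zz' /mkseq_agree xx'.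
  by rewrite zz' xx'.
apply: closedrel_and; last first.
  apply: (@closedrel_clopen q.+1) => z z' x x' _ xx'.
  rewrite xx' // (@weight_agree q x x') //; exact: agree_le xx'.
apply: closedrel_and.
  exact: (closedrel_comp cK (@evens_seq_continuous _) (@seq_continuous_id _)).
exact: (closedrel_comp cK (@odds_seq_continuous _) (@xorw_seq_continuous _)).
Qed.

Lemma cantor_scheme : exists f g : (nat -> bool) -> nat -> nat,
  [/\ seq_continuous f, seq_continuous g &
  forall x y, flip_graph S (x, y) <-> flip_graph S (u (f x), v (g y))].
Proof.
have [s [s0 sP]] := @dep_choice (crel * nat)%type (fun _ s => good s.1) refines
  (K0, 0) good_K0 (fun n s gs => refine n gs).
pose K n := (s n).1; pose k n := (s n.+1).2.
have kS n : k n < k n.+1 by have [_ []] := sP n.+1.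
have KS n z x : K n.+1 z x ->
  [/\ K n (evens z) x, K n (odds z) (xorw (delta (k n)) x), x (k n) = false &
    forall i, i <= n -> S (weight x (k n) + i) = S i].
  by have [_ [_ + _]] := sP n; apply.
have Ku n z x z' x' : K n z x -> K n z' x' ->
    agree (n * 2 ^ n) z z' /\ agree (n * 2 ^ n) x x'.
  by case: n => [|n]; [|have [_ [_ _ +]] := sP n; apply].
have le_k n : n <= k n.
  by elim: n => // n IHn; apply: leq_ltn_trans (kS n).
have k_inj : injective k.
  by apply: incn_inj; apply: leq_mono; apply: homo_ltn ltn_trans kS.
have Kk n j z x : j < n -> K n z x -> x (k j) = false /\
    forall i, i <= j -> S (weight x (k j) + i) = S i.
  elim: n z => // n IHn z; rewrite ltnS leq_eqVlt => /orP[/eqP->|jn] /KS[Kx _ xk xS] //.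
  exact: IHn Kx.
pose step n c (t : (nat -> nat) * (nat -> bool)) : (nat -> nat) * (nat -> bool) :=
  if c n : bool then (odds t.1, xorw (delta (k n)) t.2) else (evens t.1, t.2).
pose desc := fix desc n c t {struct n} := if n is m.+1 then desc m c (step m c t) else t.
have K_step n c t : K n.+1 t.1 t.2 -> K n (step n c t).1 (step n c t).2.
  by move=> /KS[]; rewrite /step; case: (c n).
have K_desc n c t : K n t.1 t.2 -> K 0 (desc n c t).1 (desc n c t).2.
  by elim: n t => //= n IHn t Kt; apply/IHn/K_step.
have desc1_agree l n c t t' : agree (l * 2 ^ n) t.1 t'.1 ->
    agree l (desc n c t).1 (desc n c t').1.
  elim: n t t' => [|n IHn] t t' /=; first by rewrite muln1.
  rewrite expnS mulnCA mul2n => tt'; apply: IHn; rewrite /step.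
  by case: (c n); [apply: odds_agree|apply: evens_agree].
have desc2_agree l n c t t' : agree l t.2 t'.2 -> agree l (desc n c t).2 (desc n c t').2.
  elim: n t t' => [|n IHn] t t' //= tt'; apply: IHn; rewrite /step.
  by case: (c n) => //; apply: xorw_agree.
have desc_local n c c' t : agree n c c' -> desc n c t = desc n c' t.
  elim: n t => //= n IHn t cc'; rewrite /step cc' //.
  by apply: IHn; apply: agree_le cc'.
have desc_off n c t i : (forall j, k j <> i) -> (desc n c t).2 i = t.2 i.
  move=> ki; elim: n t => //= n IHn t; rewrite IHn /step; case: (c n) => //=.
  by rewrite delta_neq //; apply/eqP => /esym/ki.
have desc_high n c t j : n <= j -> (desc n c t).2 (k j) = t.2 (k j).
  elim: n t => // n IHn t nj; rewrite [desc _ _ _]/= IHn; last exact: ltnW.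
  rewrite /step; case: (c n); last by [].
  rewrite [LHS]/= delta_neq; first by [].
  by rewrite (inj_eq k_inj) gtn_eqF.
have desc_k n c t j : j < n -> (desc n c t).2 (k j) = c j (+) t.2 (k j).
  elim: n t => // n IHn t; rewrite ltnS leq_eqVlt [desc _ _ _]/= => /orP[/eqP->|jn].
    rewrite desc_high; last by [].
    rewrite /step; case: (c n); last by [].
    by rewrite [LHS]/= deltaE.
  rewrite IHn; last by [].
  congr addb; rewrite /step; case: (c n); last by [].
  rewrite [LHS]/= delta_neq; first by [].
  by rewrite (inj_eq k_inj) ltn_eqF.
(* An empty relation would have a small projection. *)
have /choice[t tP] : forall n, exists t : (nat -> nat) * (nat -> bool), K n t.1 t.2.
  move=> n; have [[_ nK] _] := sP n; apply: contrapT => nt; apply: nK.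
  exists (fun=> set0); split=> [_|x [z Kz]]; first by split=> //; exact: borelc_set0.
  by exfalso; apply: nt; exists (z, x).
have le_n2 n : n <= n * 2 ^ n by rewrite leq_pmulr // expn_gt0.
have [x xP] : exists x, forall n, agree n x (t n).2.
  apply: agree_lim => n; have [Kt _ _ _] := KS _ _ _ (tP n.+1).
  have [_] := Ku _ _ _ _ _ (tP n) Kt; exact: agree_le.
have desc_lim c n : K n (step n c (t n.+1)).1 (step n c (t n.+1)).2 by apply: K_step.
(* The descent halves the witness [n] times, so the [n * 2 ^ n] entries shared by the [n]-th
   relation leave [n] of them. *)
have /choice[Z ZP] c : exists z, forall n, agree n z (desc n c (t n)).1.
  apply: agree_lim => n /=; apply: desc1_agree.
  by have [] := Ku _ _ _ _ _ (tP n) (desc_lim c n).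
have /choice[h hP] c : exists z, forall n, agree n z (desc n c (t n)).2.
  apply: agree_lim => n /=; apply: desc2_agree.
  have [_] := Ku _ _ _ _ _ (tP n) (desc_lim c n); exact: agree_le.
have Kh c : K0 (Z c) (h c).
  rewrite -[K0]/(K0, 0).1 -s0; have [[cK _] _] := sP 0; apply: cK => n.
  by exists (desc n c (t n)).1, (desc n c (t n)).2; split=> //; apply: K_desc.
have Zc : seq_continuous Z.
  move=> c n; exists n => c' cc'; apply: agree_trans (ZP c n) _.
  by rewrite (desc_local _ _ _ _ cc'); apply: agree_sym.
exists (@evens _ \o Z), (@odds _ \o Z); split.
- exact: seq_continuous_comp (@evens_seq_continuous _) Zc.
- exact: seq_continuous_comp (@odds_seq_continuous _) Zc.
(* Both [u (f c)] and [v (g c)] equal [h c], so it remains to see that [h] embeds the graph into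
   itself. *)
move=> c c' /=; have [-> _] := Kh c; have [_ ->] := Kh c'.
have xk n : x (k n) = false.
  rewrite (xP (k n).+1) //; have [|+ _] := Kk (k n).+1 n _ _ _ (tP _); last by [].
  by rewrite ltnS.
apply: (@flip_graph_embedding k x h) => //.
- move=> d n; rewrite (hP d (k n).+1) // desc_k ?ltnS //.
  by have [|-> _] := Kk (k n).+1 n _ _ _ (tP _); rewrite ?ltnS ?addbF.
- move=> d i ki; rewrite (hP d i.+1) // desc_off //.
  by rewrite (xP i.+1).
- move=> n i i_n; rewrite (@weight_agree _ _ (t (k n).+1).2).
    by have [|_ ->] := Kk (k n).+1 n _ _ _ (tP _); rewrite ?ltnS.
  exact: agree_le (xP _).
Qed.

End CantorScheme.

(** * Rigidity *)

Lemma flip_graph_irr S x : ~ flip_graph S (x, x).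
Proof. by move=> [k /= [_ _ /(congr1 (@^~ k))]]; rewrite deltaE; case: (x k). Qed.

Lemma flip_graph_at S x y i : flip_graph S (x, y) -> x i <> y i ->
  [/\ x i = false, S (weight x i) & y = xorw (delta i) x].
Proof.
move=> [k /= [xk Sk yE]] xyi; have [ik|/eqP ik] := eqVneq i k; first by subst i.
by case: xyi; rewrite yE delta_neq //; apply/eqP.
Qed.

(** At a bit [i] where [x] and [y] differ, close approximants differ too, so they flip exactly [i]
    and the flipped position cannot escape to infinity. *)
Lemma flip_graph_closed S x y :
  (forall n, exists x' y', [/\ agree n x x', agree n y y' & flip_graph S (x', y')]) ->
  x <> y -> flip_graph S (x, y).
Proof.
move=> xy /eqP nxy.
have [i xyi] : exists i, x i <> y i.
  apply: contrapT => nxyi; case/eqP: nxy; apply/funext => i.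
  by apply: contrapT => xyi; apply: nxyi; exists i.
have near n : exists x' y', [/\ agree (maxn n i.+1) x x', agree (maxn n i.+1) y y',
    x' i = false, S (weight x' i) & y' = xorw (delta i) x'].
  have [x' [y' [xx' yy' g]]] := xy (maxn n i.+1).
  have le_i : i < maxn n i.+1 by rewrite leq_max ltnSn orbT.
  have [|? ? ?] := flip_graph_at g (i := i); first by rewrite -xx' // -yy'.
  by exists x', y'.
exists i; split=> /=.
- have [x' [y' [xx' _ <- _ _]]] := near 0; exact: xx'.
- have [x' [y' [xx' _ _ Sx' _]]] := near 0; rewrite (@weight_agree _ _ x') //.
  by apply: agree_le xx'; rewrite leqW ?leq_maxr // max0n.
- apply: agree_all => n; have [x' [y' [xx' yy' _ _ y'E]]] := near n.
  apply: (@agree_trans _ _ y'); first by apply: agree_le yy'; apply: leq_maxl.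
  rewrite y'E; apply: xorw_agree; apply: agree_sym.
  by apply: agree_le xx'; apply: leq_maxl.
Qed.

(** Every diagonal point is a limit of edges: after the prefix, [j] ones raise the weight to a value
    satisfying [S]. *)
Lemma flip_graph_near (S : pred nat) x n : (forall c, exists j, S (c + j)) ->
  exists y z, [/\ agree n x y, agree n x z & flip_graph S (y, z)].
Proof.
move=> /(_ (weight x n))[j Sj].
pose y : nat -> bool := fun i => if i < n then x i else i < n + j.
have xy : agree n x y by move=> i ltin; rewrite /y ltin.
have wy d : d <= j -> weight y (n + d) = weight x n + d.
  elim: d => [|d IHd] dj; first by rewrite !addn0 (weight_agree xy).
  rewrite addnS /= IHd ?(ltnW dj) // /y ltnNge leq_addr /= ltn_add2l dj.
  by rewrite addn1 addnS.
exists y, (xorw (delta (n + j)) y); split=> //.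
  apply: agree_trans xy _.
  by apply: (@agree_le _ _ (n + j)); [apply: leq_addr|apply: delta_agree].
exists (n + j); split=> //=; last by rewrite wy.
by rewrite /y ltnNge leq_addr ltnn.
Qed.

Section Rigidity.
Variables (S S' : pred nat) (u : (nat -> bool) -> nat -> bool).
Hypotheses (uc : seq_continuous u) (S0 : S 0).
Hypothesis uS : forall x y, flip_graph S (x, y) <-> flip_graph S' (u x, u y).

Let zero : nat -> bool := fun=> false.

Let weight_zero k : weight zero k = 0.
Proof. by elim: k => //= k ->. Qed.

Let edge0 k y : agree k.+1 zero y -> flip_graph S (y, xorw (delta k) y).
Proof.
move=> zy; exists k; split=> //=; first by rewrite -zy.
by rewrite -(@weight_agree k zero) ?weight_zero //; apply: agree_le zy.
Qed.

(** Near 0 every flip at [k] is an edge by [S 0], so its image flips one bit. That bit is the same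
    [k'] for all [y] near 0, by continuity at 0 and at its flip, and it is at least [B] once [k] is
    large. *)
Let flip_image N B : exists k k' M, [/\ N <= k, B <= k', u zero k' = false, k < M &
  forall y, agree M zero y -> u (xorw (delta k) y) = xorw (delta k') (u y)].
Proof.
have [m mP] := uc zero B.
pose k := maxn N m.
have [k' /= [zk' _ k'E]] := (uS _ _).1 (@edge0 k zero (@agree_refl _ _ _)).
have Bk' : B <= k'.
  rewrite leqNgt; apply/negP => k'B.
  have := mP (xorw (delta k) zero) (agree_le (leq_maxr N m) (@delta_agree k zero)) k' k'B.
  by rewrite k'E deltaE; case: (u zero k').
have [p pP] := uc zero k'.+1; have [q qP] := uc (xorw (delta k) zero) k'.+1.
exists k, k', (maxn k.+1 (maxn p q)); split=> //; [exact: leq_maxl|by rewrite leq_maxl|].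
move=> y zy.
have g : flip_graph S' (u y, u (xorw (delta k) y)).
  by apply/uS/edge0; apply: agree_le zy; apply: leq_maxl.
have [|//] := flip_graph_at g (i := k').
have zyp : agree p zero y by apply: agree_le zy; rewrite !leq_max leqnn !orbT.
have zyq : agree q zero y by apply: agree_le zy; rewrite !leq_max leqnn !orbT.
rewrite -(pP _ zyp) // -(qP _ (@xorw_agree (delta k) _ _ _ zyq)) //.
by rewrite k'E deltaE; case: (u zero k').
Qed.

(** Images of successive flips are composed: [a j] consists of [j] flips, and [u] turns it into
    [b j], which adds [j] ones to [u zero]. Each new flip lies beyond the previous ones on both
    sides. *)
Let flip_chain m : exists N B (a b : nat -> nat -> bool), forall j, j <= m -> [/\
  forall y, agree N zero y -> u (xorw (a j) y) = xorw (b j) (u y),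
  forall i, N <= i -> a j i = false,
  forall i, N <= i -> weight (a j) i = j,
  forall i, B <= i -> b j i = false &
  forall i, B <= i -> weight (xorw (b j) (u zero)) i = weight (u zero) i + j].
Proof.
elim: m => [|m [N [B [a [b abP]]]]].
  exists 0, 0, (fun=> zero), (fun=> zero) => j; rewrite leqn0 => /eqP->; split=> //.
  by move=> i _; rewrite xorw0 addn0.
have [k [k' [M [Nk Bk' zk' kM MP]]]] := flip_image N B.
have [a_u a_out a_w b_out b_w] := abP m (leqnn m).
have NM : N <= M by rewrite (leq_trans Nk) // ltnW.
exists M, k'.+1.
exists (fun j => if j == m.+1 then xorw (delta k) (a m) else a j).
exists (fun j => if j == m.+1 then xorw (delta k') (b m) else b j) => j.
rewrite leq_eqVlt => /orP[/eqP->|]; last first.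
  rewrite ltnS => jm; rewrite ltn_eqF //; have [ju ja jaw jb jbw] := abP j jm; split.
  - by move=> y zy; apply: ju; apply: agree_le zy.
  - by move=> i Mi; apply: ja; apply: leq_trans Mi.
  - by move=> i Mi; apply: jaw; apply: leq_trans Mi.
  - by move=> i k'i; apply: jb; apply: leq_trans Bk' (ltnW k'i).
  - by move=> i k'i; apply: jbw; apply: leq_trans Bk' (ltnW k'i).
rewrite eqxx; split.
- move=> y zy; rewrite -xorwA xorwCA a_u.
    by rewrite MP // -xorwA xorwCA.
  apply: (@agree_trans _ _ y); first exact: agree_le zy.
  by apply: agree_le Nk _; apply: delta_agree.
- move=> i Mi; rewrite delta_neq; last by rewrite gtn_eqF // (leq_trans kM).
  by apply: a_out; apply: leq_trans Mi.
- move=> i Mi; rewrite weight_xorw_delta ?a_w //; [exact: leq_trans Mi|exact: leq_trans Mi|].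
  exact: a_out.
- move=> i k'i; rewrite delta_neq; last by rewrite gtn_eqF.
  by apply: b_out; apply: leq_trans Bk' (ltnW k'i).
- move=> i k'i; rewrite -xorwA weight_xorw_delta //; last by rewrite /xorw zk' b_out.
  by rewrite b_w ?addnS // (leq_trans Bk' (ltnW k'i)).
Qed.

Lemma flip_graph_rigid : prefixes_occur S S'.
Proof.
move=> m; have [N [B [a [b abP]]]] := flip_chain m.
have [k [k' [M [Nk Bk' zk' _ MP]]]] := flip_image N B.
(* After the [j] flips of [a j], the flip at [k] is an edge iff [S j]; on the image side, the flip
   at [k'] is one iff [S'] holds at this weight plus [j]. *)
exists (weight (u zero) k') => j jm.
have [a_u a_out a_w b_out b_w] := abP j jm.
have az : xorw (a j) zero = a j by apply/funext => i; rewrite /xorw addbF.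
have uE : flip_graph S (xorw (a j) zero, xorw (a j) (xorw (delta k) zero)) <->
    flip_graph S' (xorw (b j) (u zero), xorw (b j) (xorw (delta k') (u zero))).
  rewrite uS a_u // a_u ?MP //; exact: agree_le Nk (@delta_agree _ _).
have edgeE (T : pred nat) x p i : x i = p i -> flip_graph T (xorw p x, xorw p (xorw (delta i) x)) <->
    T (weight (xorw p x) i).
  move=> xi; rewrite xorwCA; split=> [g|Ti]; last by exists i; rewrite /= {1}/xorw xi addbb.
  by have [|_ ? _//] := flip_graph_at g (i := i); rewrite deltaE; case: (_ i).
rewrite edgeE in uE; last by rewrite a_out.
rewrite edgeE in uE; last by rewrite zk' b_out.
rewrite az a_w // b_w // in uE.
by apply/idP/idP => /uE.
Qed.

End Rigidity.

(** Edges converging to [(x, x)] have images converging to [(u x, v x)]. Were the two values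
    distinct, this limit would be an edge, and so would [(x, x)]. *)
Lemma flip_graph_reduction_eq (S S' : pred nat) u v :
  (forall c, exists j, S (c + j)) -> seq_continuous u -> seq_continuous v ->
  (forall x y, flip_graph S (x, y) <-> flip_graph S' (u x, v y)) -> u = v.
Proof.
move=> Sinf uc vc uv; apply/funext => x; apply: contrapT => /flip_graph_closed nuv.
apply: (@flip_graph_irr S x); apply/uv/nuv => n.
have [p pP] := uc x n; have [q qP] := vc x n.
have [y [z [xy xz /uv g]]] := flip_graph_near x (maxn p q) Sinf.
exists (u y), (v z); split=> //; [apply: pP|apply: qP].
  by apply: agree_le xy; apply: leq_maxl.
by apply: agree_le xz; apply: leq_maxr.
Qed.

Import Order.TTheory GRing.Theory Num.Theory.

(** * Distances on bare types, with rates of convergence in powers of 1/2 *)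

Section Distances.
Local Open Scope ring_scope.
Variable R : realType.

Definition half_pow (n : nat) : R := 2^-1 ^+ n.

Lemma half_pow_gt0 n : 0 < half_pow n.
Proof. by rewrite exprn_gt0 // invr_gt0. Qed.

Lemma half_powS n : half_pow n.+1 = half_pow n / 2.
Proof. by rewrite /half_pow exprSr. Qed.

Lemma half_pow_anti m n : (m <= n)%N -> half_pow n <= half_pow m.
Proof.
move=> /subnK<-; elim: (n - m)%N => //= d; rewrite addSn half_powS.
by have := half_pow_gt0 (d + m); lra.
Qed.

Lemma half_pow_leE m n : (half_pow n <= half_pow m) = (m <= n)%N.
Proof.
apply/idP/idP => [|/half_pow_anti//]; apply: contraTT; rewrite -ltnNge => /half_pow_anti.
by rewrite half_powS -ltNge; have := half_pow_gt0 n; lra.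
Qed.

Lemma half_pow_small (c e : R) : 0 < e -> exists n, c * half_pow n < e.
Proof.
move=> e0; have [n nP] : exists n : nat, c / e < n%:R.
  exists (Num.bound `|c / e|); apply: le_lt_trans (ler_norm _) _.
  by rewrite archi_boundP // normr_ge0.
have n2 : n%:R * half_pow n <= 1.
  elim: n {nP} => [|n IHn]; first by rewrite mul0r.
  have h1 : half_pow n <= 1 by rewrite -[1]/(half_pow 0) half_pow_leE.
  by rewrite half_powS -natr1; lra.
exists n; have [c0|c0] := leP c 0.
  apply: le_lt_trans e0; rewrite mulr_le0_ge0 // ltW //; exact: half_pow_gt0.
have : c / e * half_pow n < 1.
  by apply: lt_le_trans n2; rewrite ltr_pM2r // half_pow_gt0.
by rewrite mulrAC ltr_pdivrMr // mul1r.
Qed.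

Definition is_dist (T : Type) (d : T -> T -> R) :=
  [/\ forall x, d x x = 0, forall x y, d x y = 0 -> x = y,
      forall x y, d x y = d y x & forall y x z, d x z <= d x y + d y z].

(** Sequences with geometric steps suffice to test completeness. Their tails are bounded by
    [2 * half_pow n]; the constant 4 leaves room for estimates. *)
Definition dist_complete (T : Type) (d : T -> T -> R) := forall s : nat -> T,
  (forall n, d (s n) (s n.+1) <= half_pow n) ->
  exists l, forall n, d l (s n) <= 4 * half_pow n.

Definition dist_separable (T : Type) (d : T -> T -> R) :=
  exists2 D : set T, countable D & forall x e, 0 < e -> exists2 y, D y & d x y < e.

Lemma dist_ge0 T (d : T -> T -> R) x y : is_dist d -> 0 <= d x y.
Proof. by move=> [dxx _ ds dt]; have := dt y x x; rewrite dxx (ds y x); lra. Qed.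

Lemma dist_sum T (d : T -> T -> R) (s : nat -> T) m n : is_dist d ->
  (forall n, d (s n) (s n.+1) <= half_pow n) -> (m <= n)%N ->
  d (s m) (s n) <= 2 * half_pow m.
Proof.
move=> [dxx _ ds dt] sP /subnK<-.
suff : d (s m) (s (n - m + m)%N) <= 2 * half_pow m - 2 * half_pow (n - m + m).
  by have := half_pow_gt0 (n - m + m); lra.
elim: (n - m)%N => [|k IHk]; first by rewrite add0n dxx subrr.
have := dt (s (k + m)%N) (s m) (s (k.+1 + m)%N); have := sP (k + m)%N.
by rewrite addSn half_powS; lra.
Qed.

Lemma dist_eq T (d : T -> T -> R) c x y : is_dist d ->
  (forall n, d x y <= c * half_pow n) -> x = y.
Proof.
move=> dd dP; have [_ d0 _ _] := dd; apply: d0; apply/eqP.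
rewrite eq_le (dist_ge0 _ _ dd) andbT leNgt; apply/negP => /(half_pow_small c)[n].
by rewrite ltNge dP.
Qed.

(** * Polish topologies and distances *)

Definition dist_type (T : choiceType) (d : T -> T -> R) (dd : is_dist d) : Type := T.

Section DistType.
Variables (T : choiceType) (d : T -> T -> R) (dd : is_dist d).

Let dxx : forall x, d x x = 0. Proof. by have [] := dd. Qed.
Let d0 : forall x y, d x y = 0 -> x = y. Proof. by have [] := dd. Qed.
Let dsym : forall x y, d x y = d y x. Proof. by have [] := dd. Qed.
Let dtri : forall y x z, d x z <= d x y + d y z. Proof. by have [] := dd. Qed.

HB.instance Definition _ := Choice.on (dist_type dd).
HB.instance Definition _ := isMetric.Build R (dist_type dd) dxx d0 dsym dtri.

Lemma nbhs_dist_type (x : dist_type dd) (U : set (dist_type dd)) :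
  nbhs x U <-> exists2 e, 0 < e & forall y, d x y < e -> U y.
Proof.
by split=> [/nbhs_ballP[e /= e0 eU]|[e e0 eU]]; [|apply/nbhs_ballP]; exists e => // y;
  have := eU y; rewrite ballEmdist.
Qed.

Lemma polish_dist_type : dist_complete d -> dist_separable d ->
  polish R (dist_type dd).
Proof.
move=> dc [D cD dD]; split.
  exists D => // O [x Ox] oO; have /nbhs_dist_type[e e0 eO] : nbhs x O.
    by apply: open_nbhs_nbhs.
  by have [y Dy xy] := dD x e e0; exists y; split=> //; apply: eO.
exists (Metric.class (dist_type dd)); split=> // F PF cF.
have FF : Filter F by apply: filter_filter.
have cex : forall e : R, 0 < e -> exists x : dist_type dd, F [set y | d x y < e].
  move=> e e0; have /cauchyP/(_ e e0)[x Fx] := cF; exists x.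
  by move: Fx; rewrite ballEmdist.
(* Two balls of the filter meet, so with these radii consecutive centres are within [half_pow n]. *)
have /choice[s sP] : forall n, exists x : dist_type dd, F [set y | d x y < half_pow n.+2].
  by move=> n; apply: cex; apply: half_pow_gt0.
have [n|l lP] := dc s.
  have [y [/= + /= +]] := @filter_ex _ F PF _ (filterI (sP n) (sP n.+1)).
  have := dtri y (s n) (s n.+1); rewrite (dsym y (s n.+1)) !half_powS.
  by have := half_pow_gt0 n; lra.
exists l => U /nbhs_dist_type[e e0 eU].
have [n ne] := half_pow_small 5 e0.
apply: filterS (sP n) => y /= sy; apply: eU.
have := dtri (s n) l y; have := lP n; have := half_pow_gt0 n.
by rewrite !half_powS in sy; lra.
Qed.

End DistType.

Lemma polish_dist (T : topologicalType) : polish R T -> exists d : T -> T -> R,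
  [/\ is_dist d, dist_complete d, dist_separable d &
      forall x U, nbhs x U <-> exists2 e, 0 < e & forall y, d x y < e -> U y].
Proof.
move=> [[D cD dD] [m]]; set M := Metric.Pack m => /= -[nbhsE cM].
pose d : T -> T -> R := fun x y => @mdist R M x y.
have dd : is_dist d.
  split=> [x|x y|x y|y x z]; rewrite /d.
  - exact: (@mdistxx R M).
  - exact: (@mdist_positivity R M).
  - exact: (@metric_sym R M).
  - exact: (@metric_triangle R M).
have dnbhs x U : nbhs x U <-> exists2 e, 0 < e & forall y, d x y < e -> U y.
  rewrite -nbhsE; split=> [/(@nbhs_ballP R M)[e /= e0 eU]|[e e0 eU]].
    by exists e => // y xy; apply: eU; rewrite ballEmdist.
  by apply/(@nbhs_ballP R M); exists e => // y; rewrite ballEmdist; apply: eU.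
exists d; split=> //.
- move=> s sP; pose F : set_system M := [set U | exists N, forall n, (N <= n)%N -> U (s n)].
  have PF : ProperFilter F.
    split; first by move=> [N /(_ N (leqnn N))].
    split.
    - by exists 0%N.
    - move=> P Q [N1 N1P] [N2 N2P]; exists (maxn N1 N2) => n; rewrite geq_max => /andP[? ?].
      by split; [apply: N1P|apply: N2P].
    - by move=> P Q PQ [N NP]; exists N => n /NP/PQ.
  have [|l lP] := cM F PF.
    apply/cauchy_exP => e e0; have [N Ne] := half_pow_small 2 e0.
    exists (s N), N => n Nn; rewrite ballEmdist /=.
    exact: le_lt_trans (dist_sum dd sP Nn) Ne.
  exists l => n; have [_ _ dsym dtri] := dd.
  have [N NP] : F [set y | d l y < half_pow n].
    apply: lP; rewrite nbhsE; apply/dnbhs; exists (half_pow n) => //.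
    exact: half_pow_gt0.
  have := NP (maxn n N) (leq_maxr _ _); have := dist_sum dd sP (leq_maxl n N).
  have := dtri (s (maxn n N)) l (s n); rewrite /= (dsym (s (maxn n N)) (s n)).
  by have := half_pow_gt0 n; lra.
- exists D => // x e e0.
  have [|y [+ Dy]] := dD (@interior T [set y | d x y < e]) _ (@open_interior T _).
    by exists x; apply/dnbhs; exists e.
  by move=> /interior_subset xy; exists y.
Qed.
End Distances.

(** * Polish spaces as images of the Baire space, and refinements of their topologies *)

Lemma countable_enum T (D : set T) x0 : countable D -> D x0 ->
  exists q : nat -> T, forall y, D y -> exists i, q i = y.
Proof.
move=> /countable_injP[f fD] Dx0.
have /choice[q qP] : forall i, exists y, (exists2 y', D y' & f y' = i) -> D y /\ f y = i.
  move=> i; have [[y Dy fy]|ny] := pselect (exists2 y', D y' & f y' = i).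
    by exists y.
  by exists x0.
exists q => y Dy; exists (f y).
have [Dq fq] : D (q (f y)) /\ f (q (f y)) = f y by apply: qP; exists y.
by apply: fD => //; rewrite inE.
Qed.

Section PolishSpaces.
Local Open Scope ring_scope.
Variable R : realType.
Local Notation half_pow := (@half_pow R).

Lemma polish_image_baire (T : topologicalType) (t0 : T) : polish R T ->
  exists p : (nat -> nat) -> T,
    (forall z U, nbhs (p z) U -> exists n, forall y, agree n z y -> U (p y)) /\
    forall t, exists z, p z = t.
Proof.
move=> /polish_dist[d [dd dc [D cD dD] dnbhs]]; have [dxx _ dsym dtri] := dd.
have [y0 Dy0 _] := dD t0 1 ltr01.
have [q Dq] := countable_enum cD Dy0.
have qP x n : exists i, d x (q i) < half_pow n.
  have [y /Dq[i <-] xy] := dD x _ (half_pow_gt0 R n); by exists i.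
(* The next dense point is accepted only if it is close to the current one; thus every [z] yields a
   convergent sequence. *)
pose pt := fix pt (z : nat -> nat) (n : nat) {struct n} : T := if n is m.+1 then
  if d (pt z m) (q (z n)) < half_pow m then q (z n) else pt z m else q (z 0%N).
have pt_agree n z z' : agree n.+1 z z' -> pt z n = pt z' n.
  elim: n => [|n IHn] zz'; first by rewrite /= zz'.
  by rewrite [LHS]/= [RHS]/= IHn ?zz' //; apply: agree_le zz'.
have ptS z n : d (pt z n) (pt z n.+1) <= half_pow n.
  rewrite [pt z n.+1]/=; case: ifPn => [/ltW//|_].
  by rewrite dxx ltW // half_pow_gt0.
have /choice[p pP] : forall z, exists l, forall n, d l (pt z n) <= 4 * half_pow n.
  by move=> z; apply: dc.
exists p; split=> [z U /dnbhs[e e0 eU]|t].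
  have [n ne] := half_pow_small 8 e0.
  exists n.+1 => y zy; apply: eU; apply: le_lt_trans ne.
  have := dtri (pt z n) (p z) (p y); have := pP z n; have := pP y n.
  by rewrite (pt_agree _ _ _ zy) (dsym (pt y n)); lra.
(* Approximating [t] this closely ensures that every step is accepted. *)
have /choice[z zP] : forall n, exists i, d t (q i) < half_pow n.+2 by move=> n.
have ptE n : pt z n = q (z n).
  elim: n => // n IHn; rewrite [LHS]/= IHn ifT //.
  have := dtri t (q (z n)) (q (z n.+1)); have := zP n; have := zP n.+1.
  by rewrite (dsym (q (z n)) t) !half_powS; have := half_pow_gt0 R n; lra.
exists z; apply: (@dist_eq _ _ d 5 _ _ dd) => n.
have := dtri (q (z n)) (p z) t; have := pP z n; have := zP n.
rewrite ptE (dsym (q (z n)) t) !half_powS; have := half_pow_gt0 R n; lra.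
Qed.

Definition baire_dist (z z' : nat -> nat) : R :=
  if pselect (exists i, z i != z' i) is left e then half_pow (ex_minn e) else 0.

Lemma baire_dist_le n z z' : baire_dist z z' <= half_pow n <-> agree n z z'.
Proof.
rewrite /baire_dist; case: pselect => [e|ne].
  case: ex_minnP => m mz mmin; rewrite half_pow_leE.
  split=> [nm i ltin|zz']; last first.
    by rewrite leqNgt; apply: contra mz => /zz'->.
  by apply/eqP; apply: contraTT nm => /mmin; rewrite -ltnNge => /leq_ltn_trans; apply.
split=> [_ i _|_]; last by rewrite ltW // half_pow_gt0.
by apply/eqP; apply: contra_notT ne => zi; exists i.
Qed.

Lemma baire_dist_cases z z' : baire_dist z z' = 0 \/ exists n, baire_dist z z' = half_pow n.
Proof. by rewrite /baire_dist; case: pselect => [e|_]; [right; exists (ex_minn e)|left]. Qed.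

Lemma baire_dist_is_dist : is_dist baire_dist.
Proof.
have ge0 z z' : 0 <= baire_dist z z'.
  have [->//|[n ->]] := baire_dist_cases z z'; by rewrite ltW // half_pow_gt0.
have eq0 z z' : (forall n, agree n z z') -> baire_dist z z' = 0.
  move=> zz'; apply/eqP; rewrite eq_le ge0 andbT leNgt; apply/negP => /(half_pow_small 1)[n].
  by rewrite mul1r ltNge => /negP; apply; apply/baire_dist_le.
have dist0 z z' : baire_dist z z' = 0 -> z = z'.
  move=> d0; apply: agree_all => n; apply/baire_dist_le.
  by rewrite d0 ltW // half_pow_gt0.
split=> // [x|x y|y x z]; first exact: eq0.
  suff le x' y' : baire_dist x' y' <= baire_dist y' x'.
    by apply/eqP; rewrite eq_le !le.
  have [/dist0->|[n yx]] := baire_dist_cases y' x'; first by [].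
  by rewrite yx; apply/baire_dist_le/agree_sym/baire_dist_le; rewrite yx.
have [/dist0->|[m xy]] := baire_dist_cases x y; first by rewrite lerDr.
have [/dist0->|[n yz]] := baire_dist_cases y z; first by rewrite lerDl.
have xz : baire_dist x z <= half_pow (minn m n).
  apply/baire_dist_le/(@agree_trans _ _ y).
    by apply: (agree_le (geq_minl m n)); apply/baire_dist_le; rewrite xy.
  by apply: (agree_le (geq_minr m n)); apply/baire_dist_le; rewrite yz.
rewrite xy yz (le_trans xz) // /minn; case: ifP => _.
  by rewrite lerDl ltW // half_pow_gt0.
by rewrite lerDr ltW // half_pow_gt0.
Qed.

(** The new distance is that of the graph of [W] in the product of [X] and the Baire space. It is
    complete because this graph is closed, and it controls the entries of [W] that decide membership
    in each [D n]. *)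
Lemma finer_polish_open (X : topologicalType) (u : X -> nat -> bool)
    (D : nat -> set (nat -> bool)) :
  polish R X -> (forall x n, nbhs x [set y | agree n (u x) (u y)]) ->
  (forall n, borelc (D n)) ->
  exists2 s : Topological X, finer_polish R s &
    forall n, @open (Topological.Pack s) (u @^-1` D n).
Proof.
move=> /polish_dist[d [dd dc [Q cQ dQ] dnbhs]] uc /(_ _)/borelc_graph bD.
have /choice[w wP] : forall n, exists w, closedrel (fun z x => w x = z) /\
    forall x, D n x <-> (0 < w x 0)%N by move=> n; have [w] := bD n; exists w.
have Wc := closedrel_join (fun n => (wP n).1).
pose W x := join w (u x).
have [dxx d0 dsym dtri] := dd.
have [bxx b0 bsym btri] := baire_dist_is_dist.
pose d' x y := d x y + baire_dist (W x) (W y).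
have dle x y : d x y <= d' x y by rewrite lerDl (dist_ge0 _ _ baire_dist_is_dist).
have ble x y : baire_dist (W x) (W y) <= d' x y by rewrite lerDr (dist_ge0 _ _ dd).
have dd' : is_dist d'.
  split=> [x|x y|x y|y x z]; rewrite /d'.
  - by rewrite dxx bxx addr0.
  - move=> d'0; apply: d0; have := dle x y; have := dist_ge0 x y dd; rewrite /d' d'0.
    by move=> ? ?; apply/eqP; rewrite eq_le; apply/andP.
  - by rewrite dsym bsym.
  - by have := dtri y x z; have := btri (W y) (W x) (W z); lra.
have dc' : dist_complete d'.
  move=> s sP; have [l lP] := dc s (fun n => le_trans (dle _ _) (sP n)).
  have [z zP] : exists z, forall n, agree n z (W (s n)).
    by apply: agree_lim => n; apply/baire_dist_le/(le_trans (ble _ _)).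
  have WE : W l = z.
    apply: Wc => n; have [e e0 eU] := (dnbhs _ _).1 (uc l n).
    have [m me] := half_pow_small 4 e0.
    exists (W (s (maxn m n))), (u (s (maxn m n))); split=> //.
      exact: agree_le (leq_maxr m n) (zP _).
    apply: eU; apply: le_lt_trans (lP _) (le_lt_trans _ me).
    by rewrite ler_pM2l // half_pow_anti // leq_maxl.
  exists l => n; have [k kP] := half_pow_small 4 (half_pow_gt0 R n).
  pose m := maxn n k.
  have h1 : baire_dist (W l) (W (s m)) <= half_pow m by rewrite WE; apply/baire_dist_le.
  have h2 := dist_sum dd' sP (leq_maxl n k).
  have h3 : d l (s m) <= half_pow n.
    apply: le_trans (lP m) (le_trans _ (ltW kP)).
    by rewrite ler_pM2l // half_pow_anti // leq_maxr.
  have h4 : half_pow m <= half_pow n by apply: half_pow_anti; apply: leq_maxl.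
  have [_ _ d'sym d'tri] := dd'.
  have h5 : d' l (s m) = d l (s m) + baire_dist (W l) (W (s m)) by [].
  have := d'tri (s m) l (s n); rewrite (d'sym (s m)) h5.
  by move: h2; rewrite -/m; lra.
have ds' : dist_separable d'.
  have [[x0]|nX] := pselect (exists x : X, True); last first.
    by exists set0 => // x; case: nX; exists x.
  move=> _; have [y0 Qy0 _] := dQ x0 1 ltr01.
  have [q Qq] := countable_enum cQ Qy0.
  (* A countable dense set is obtained by choosing a point in each nonempty trace of a ball times a
     cylinder. *)
  pose near (t : nat * nat * seq nat) (y : X) :=
    d (q t.1.1) y < half_pow t.1.2 /\ mkseq (W y) (size t.2) = t.2.
  have /choice[c cP] : forall t, exists y, (exists x, near t x) -> near t y.
    move=> t; have [[y ty]|nt] := pselect (exists x, near t x); first by exists y.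
    by exists x0.
  exists (range c); first exact: card_le_trans (card_image_le _ _) (countableP _).
  move=> x e e0; have [n ne] := half_pow_small 3 e0.
  have [y /Qq[i <-] xy] := dQ x _ (half_pow_gt0 R n).
  pose t := (i, n, mkseq (W x) n).
  have : near t (c t).
    by apply: cP; exists x; rewrite /near /= dsym size_mkseq.
  rewrite /near /= size_mkseq => -[h1 h2]; exists (c t); first by exists t.
  apply: le_lt_trans ne; rewrite /d'.
  have : baire_dist (W x) (W (c t)) <= half_pow n.
    apply/baire_dist_le => j jn.
    by have := congr1 (fun s => nth 0%N s j) h2; rewrite !nth_mkseq.
  by have := dtri (q i) x (c t); lra.
pose T' : topologicalType := dist_type dd'.
exists (Topological.class T'); first split.
- exact: polish_dist_type.
- move=> U oU; change (@open T' U); rewrite openE => x Ux.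
  have /dnbhs[e e0 eU] : @nbhs X X x U by apply: open_nbhs_nbhs.
  apply/nbhs_dist_type; exists e => // y xy; apply: eU.
  exact: le_lt_trans xy.
- move=> n; change (@open T' (u @^-1` D n)); rewrite openE => x Dx.
  apply/nbhs_dist_type; exists (half_pow (pickle (n, 0%N)).+1).
    exact: half_pow_gt0.
  move=> y /ltW/(le_trans (ble _ _))/baire_dist_le/(_ _ (ltnSn _)).
  rewrite /W !joinE /= => wxy.
  by apply/(wP n).2; rewrite -wxy; apply/(wP n).2.
Qed.
End PolishSpaces.

(** * The topology of the Cantor space *)

Lemma nbhs_agree (x : cantor_space) n : nbhs x [set y : cantor_space | agree n x y].
Proof.
elim: n => [|n IHn]; first by apply: filterS filterT => y _ i.
have h : nbhs x (@proj nat (fun=> bool) n @^-1` [set x n]).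
  apply: (@proj_continuous nat (fun=> bool) n x).
  by apply: discrete_set1.
apply: filterS (filterI IHn h) => y [xy xyn] i; rewrite ltnS leq_eqVlt => /orP[/eqP->|/xy//].
by rewrite -xyn.
Qed.

Lemma nbhs_cantorP (x : cantor_space) (U : set cantor_space) :
  nbhs x U <-> exists n, forall y, agree n x y -> U y.
Proof.
split=> [xU|[n nU]]; last exact: filterS (nbhs_agree x n).
pose F : set_system cantor_space := [set V | exists n, forall y, agree n x y -> V y].
have FF : Filter F.
  split; first by exists 0.
  - move=> P Q [m mP] [n nQ]; exists (maxn m n) => y xy.
    by split; [apply/mP/(agree_le _ xy)/leq_maxl|apply/nQ/(agree_le _ xy)/leq_maxr].
  - by move=> P Q PQ [n nP]; exists n => y /nP/PQ.
suff : F --> x by apply.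
apply/cvg_sup => i V [W [[B _ <-] Bx BV]]; exists i.+1 => y xy; apply: BV.
by rewrite /preimage /= -(xy i (ltnSn i)).
Qed.

Lemma continuous_cantorP (T : topologicalType) (f : cantor_space -> T) :
  continuous f <-> forall x U, nbhs (f x) U -> exists n, forall y, agree n x y -> U (f y).
Proof.
by split=> [fc x U /fc/nbhs_cantorP[n nP]|fc x U /fc[n nP]];
  [exists n|apply/nbhs_cantorP; exists n].
Qed.

Lemma continuous_seq_continuous (f : cantor_space -> cantor_space) :
  continuous f <-> seq_continuous f.
Proof.
split=> [/continuous_cantorP fc x n|fc]; first exact: fc (nbhs_agree (f x) n).
apply/continuous_cantorP => x U /nbhs_cantorP[n nU]; have [m mP] := fc x n.
by exists m => y /mP/nU.
Qed.

Lemma nbhs_cantor2P (p : cantor_space * cantor_space) U : nbhs p U <->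
  exists n, forall x y, agree n p.1 x -> agree n p.2 y -> U (x, y).
Proof.
case: p => x y; split=> [[[P Q] [/= /nbhs_cantorP[m mP] /nbhs_cantorP[n nQ]] PQ]|[n nU]].
  exists (maxn m n) => x' y' /= xx' yy'; apply: PQ; split=> /=.
    by apply/mP/(agree_le _ xx')/leq_maxl.
  by apply/nQ/(agree_le _ yy')/leq_maxr.
exists ([set z | agree n x z], [set z | agree n y z]) => /=.
  by split; apply: nbhs_agree.
by move=> [x' y'] [/= xx' yy']; apply: nU.
Qed.

(** * The Borel code *)

(** For [pred0] the graph is empty and this is the complement of the diagonal, so both open sets of
    the difference have this form. *)
Definition off_flip_graph (S : pred nat) : set (cantor_space * cantor_space) :=
  [set p | p.1 <> p.2 /\ ~ flip_graph S p].

Lemma off_flip_graph_near S x y : off_flip_graph S (x, y) ->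
  exists n, forall x' y', agree n x x' -> agree n y y' -> off_flip_graph S (x', y').
Proof.
move=> [/= nxy nS].
have [i xyi] : exists i, x i <> y i.
  apply: contrapT => nxyi; apply: nxy; apply/funext => i.
  by apply: contrapT => xyi; apply: nxyi; exists i.
have [n nP] : exists n, forall x' y', agree n x x' -> agree n y y' ->
    ~ flip_graph S (x', y').
  apply: contrapT => nn; apply: nS; apply: flip_graph_closed => // n.
  apply: contrapT => nxy'; apply: nn; exists n => x' y' xx' yy' g.
  by apply: nxy'; exists x', y'.
exists (maxn n i.+1) => x' y' xx' yy'; split=> /=.
  move=> /(congr1 (@^~ i)) /=; rewrite -xx' ?leq_max ?ltnSn ?orbT //.
  by rewrite -yy' ?leq_max ?ltnSn ?orbT.
by apply: nP; [apply: agree_le xx'|apply: agree_le yy']; apply: leq_maxl.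
Qed.

Lemma open_off_flip_graph S : open (off_flip_graph S).
Proof.
rewrite openE => -[x y] /off_flip_graph_near[n nP]; apply/nbhs_cantor2P.
by exists n.
Qed.

Lemma flip_graph_pred0 : flip_graph pred0 = set0.
Proof. by rewrite -subset0 => p [k []]. Qed.

Lemma flip_graphE S : flip_graph S = off_flip_graph pred0 `\` off_flip_graph S.
Proof.
apply/seteqP; split=> [[x y] xy|[x y] [[/= nxy _] nS]].
  split; last by move=> [].
  split; last by rewrite flip_graph_pred0.
  by move=> /= xy'; move: xy; rewrite xy'; apply: flip_graph_irr.
by apply: contrapT => nxyS; apply: nS.
Qed.

(** Selects boxes given by distinct words of equal length, the second not an allowed flip of the
    first. This test reads only finitely many values of [S], hence the continuity of the codes. *)
Definition off_bit (S : pred nat) (n : nat) : bool :=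
  if (unpickle n : option (seq bool * seq bool)) is Some (s, t) then
    let x := nth false s in
    [&& size s == size t, s != t & ~~ has (fun k =>
      [&& ~~ x k, S (weight x k) & t == mkseq (xorw (delta k) x) (size s)]) (iota 0 (size s))]
  else false.

Lemma off_bitP S : off_flip_graph S =
  \bigcup_(n in [set n | off_bit S n = true]) basic_open n.
Proof.
apply/seteqP; split=> [[x y] /[dup] xyS /off_flip_graph_near[n nP]|[x y] [n]].
  have [i xyi] : exists i, x i <> y i.
    apply: contrapT => nxyi; case: xyS => /= + _; apply; apply/funext => i.
    by apply: contrapT => xyi; apply: nxyi; exists i.
  (* Long enough to show the difference at [i] and to stay in a neighbourhood free of edges. *)
  pose m := maxn n i.+1.
  exists (pickle (mkseq x m, mkseq y m)); last first.
    rewrite /basic_open pickleK.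
    by split=> j jm; rewrite size_mkseq in jm; rewrite nth_mkseq.
  rewrite /off_bit /= pickleK !size_mkseq eqxx /=; apply/andP; split.
    apply/eqP => /(congr1 (fun s => nth false s i)).
    by rewrite !nth_mkseq // /m leq_max ltnSn orbT.
  apply/hasPn => k; rewrite mem_iota add0n /= => km.
  have sx : agree m x (nth false (mkseq x m)) by move=> j jm; rewrite nth_mkseq.
  apply/negP => /and3P[xk Sk /eqP yE].
  have [] := nP x (xorw (delta k) x) (@agree_refl _ _ _) _; last first.
    move=> _; apply; exists k; split=> //=.
      by rewrite (sx k) //; apply/negbTE.
    by rewrite (weight_agree (agree_le (ltnW km) sx)).
  move=> j jn; have jm : j < m by rewrite /m leq_max jn.
  have := congr1 (fun s => nth false s j) yE; rewrite !nth_mkseq // => ->.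
  by rewrite /xorw -sx.
rewrite /= /off_bit /basic_open; case: unpickle => [[s t]|//] /and3P[/eqP st snt /hasPn nk].
move=> [/= xs yt].
have xyE : s = mkseq x (size s) /\ t = mkseq y (size s).
  split; apply: (@eq_from_nth _ false); rewrite ?size_mkseq // => i is_.
    by rewrite nth_mkseq // xs.
  by rewrite nth_mkseq ?st // yt.
have [sE tE] := xyE; split=> /=.
  by move=> xy; move: snt; rewrite sE tE xy eqxx.
move=> [k /= [xk Sk yE]].
have ks : k < size s.
  rewrite ltnNge; apply/negP => sk; move/eqP: snt; apply; rewrite sE tE.
  apply: (@eq_from_nth _ false); rewrite !size_mkseq // => i is_.
  by rewrite !nth_mkseq // yE delta_neq // ltn_eqF // (leq_trans is_).
have sx : agree (size s) (nth false s) x by move=> i is_; rewrite xs.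
have := nk k; rewrite mem_iota /= add0n => /(_ ks)/negP; apply; apply/and3P; split.
- by rewrite sx // xk.
- by rewrite (weight_agree (agree_le (ltnW ks) sx)).
- rewrite {1}tE yE; apply/eqP/(@eq_from_nth _ false); rewrite !size_mkseq // => i is_.
  by rewrite !nth_mkseq // /xorw sx.
Qed.

(* Codes the complement of the union of [off_flip_graph S] (index 0) and of the
   diagonal, itself coded as the complement of [off_flip_graph pred0] (index > 0). *)
Definition flip_code (S : pred nat) (n : nat) : bool :=
  if n is m.+4 then
    if @pickle_inv (nat * nat)%type m is Some (i, j) then
      if i is 0 then if j is l.+1 then off_bit S l else true
      else if j is l.+3 then off_bit pred0 l else 0 < j
    else false
  else n == 1.

Lemma borel_code_flip_graph S : borel_code (flip_code S) (flip_graph S).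
Proof.
have codeE i j : flip_code S (pickle (i, j)).+4 =
    if i is 0 then if j is l.+1 then off_bit S l else true
    else if j is l.+3 then off_bit pred0 l else 0 < j.
  by rewrite /= pickleK_inv.
pose F i := if i is 0 then off_flip_graph S else ~` off_flip_graph pred0.
have -> : flip_graph S = ~` (\bigcup_i F i).
  rewrite flip_graphE setDE; apply/seteqP; split=> [p [p0 pS] [[|i] _]|p nF] //.
  split; last by move=> pS; apply: nF; exists 0.
  by apply: contrapT => np; apply: nF; exists 1.
(* The first four bits are 0, 1, 0, 0: a complement, then a union. Its member 0 starts with 1, the
   others with 0, 1, 1. *)
apply: borel_code_compl => //; apply: borel_code_bigcup => // -[|i].
  rewrite /F off_bitP.
  rewrite (_ : [set n | off_bit S n = true] =
    [set n | flip_code S (pickle (0, n.+1)).+4 = true]).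
    by apply: (@borel_code_open (fun n => flip_code S (pickle (0, n)).+4)); rewrite codeE.
  by apply/seteqP; split=> n; rewrite /mkset codeE.
rewrite /F; apply: borel_code_compl; rewrite ?codeE //.
rewrite off_bitP.
rewrite (_ : [set n | off_bit pred0 n = true] =
  [set n | flip_code S (pickle (i.+1, n.+3)).+4 = true]).
  by apply: (@borel_code_open (fun n => flip_code S (pickle (i.+1, n.+2)).+4)); rewrite codeE.
by apply/seteqP; split=> n; rewrite /mkset codeE.
Qed.

Lemma toep_spread_agree n a a' : agree n a a' ->
  agree n.+1 (toep (spread a)) (toep (spread a')).
Proof.
move=> aa' i; rewrite ltnS /toep => i_n.
have : logn 2 i.+1 <= n by apply: leq_trans i_n; rewrite -ltnS ltn_logl.
case: logn => //= m mn; rewrite aa' //.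
by apply: leq_ltn_trans mn; rewrite leq_half_double leqW // -addnn leq_addr.
Qed.

Lemma off_bit_agree n (S S' : pred nat) : (forall s t,
    unpickle n = Some (s, t) :> option (seq bool * seq bool) -> agree (size s).+1 S S') ->
  off_bit S n = off_bit S' n.
Proof.
rewrite /off_bit; case: unpickle => [[s t]|//] /(_ s t erefl) SS'.
congr [&& _, _ & ~~ _]; apply: eq_in_has => k; rewrite mem_iota add0n /= => ks.
by rewrite SS' // ltnS (leq_trans (weight_le _ _)) // ltnW.
Qed.

Lemma flip_code_seq_continuous : seq_continuous (fun a => flip_code (toep (spread a))).
Proof.
move=> a n.
(* [N] exceeds the lengths of all words tested by the first [n] bits of the code. *)
have [N NP] := bounded_lt (fun m => if @pickle_inv (nat * nat)%type m is Some (_, l.+1) then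
   if (unpickle l : option (seq bool * seq bool)) is Some (s, t) then size s else 0 else 0) n.
exists N => a' aa' [|[|[|[|m]]]] //= mn.
have {}NP := NP m (ltnW (ltnW (ltnW (ltnW mn)))).
case: pickle_inv NP => [[[|i] [|l]]|] //= NP.
apply: off_bit_agree => s t st; move: NP; rewrite st => sN.
by apply: agree_le (toep_spread_agree aa'); rewrite ltnW.
Qed.

Lemma diff_open_flip_graph S : diff_open (flip_graph S : set (cantor_space * cantor_space)).
Proof.
exists (off_flip_graph pred0), (off_flip_graph S); split; last exact: flip_graphE.
  exact: open_off_flip_graph.
exact: open_off_flip_graph.
Qed.

Lemma borel_diff_open (T : topologicalType) (A : set T) : diff_open A -> borel A.
Proof.
move=> [U [V [oU oV ->]]].
have [B0 BD BU] := @smallest_sigma_algebra T setT open.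
rewrite setDE -[U]setCK -setCU -bigcup2E -setTD; apply: (BD); apply: BU => -[|[|i]] /=.
- by rewrite -setTD; apply: BD; apply: sub_sigma_algebra.
- exact: sub_sigma_algebra.
- exact: B0.
Qed.

(** * Potential closedness *)

Lemma finer_polish_nbhs (R : realType) (X : topologicalType) (s : Topological X)
    (x : X) (U : set X) :
  finer_polish R s -> nbhs x U -> @nbhs _ (Topological.Pack s) x U.
Proof.
move=> [_ fs]; rewrite nbhsE => -[V [oV Vx] VU].
apply: (@filterS (Topological.Pack s) (nbhs (x : Topological.Pack s)) _ _ _ VU).
by apply: (@open_nbhs_nbhs (Topological.Pack s)); split=> //; apply: fs.
Qed.

Lemma closedrel_word n (a : seq nat) : closedrel (fun z _ => mkseq z n = a).
Proof.
apply: (@closedrel_clopen n) => z z' _ _ zz' _ <-.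
apply: (@eq_from_nth _ 0); rewrite !size_mkseq // => i ltin.
by rewrite !nth_mkseq // zz'.
Qed.

(** Pairs of cylinders, mapped by surjections from the Baire space onto the two finer spaces, give
    countably many analytic sets [D ab]. The hulls of the independent ones miss some [x]. If the
    graph were closed, a product neighbourhood of [(x, x)] without edges would make some [D ab]
    containing [x] independent. *)
Lemma flip_graph_not_pot_closed (R : realType) (S : pred nat) :
  (forall c, exists j, S (c + j)) ->
  ~ @pot_closed R cantor_space cantor_space (flip_graph S).
Proof.
move=> Sinf [s [t [fs ft cA]]].
pose zero : nat -> bool := fun=> false.
have [p [pc psurj]] := polish_image_baire (zero : Topological.Pack s) fs.1.
have [q [qc qsurj]] := polish_image_baire (zero : Topological.Pack t) ft.1.
have pcts : seq_continuous p by move=> z n; apply: pc (finer_polish_nbhs fs (nbhs_agree _ n)).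
have qcts : seq_continuous q by move=> z n; apply: qc (finer_polish_nbhs ft (nbhs_agree _ n)).
pose D (ab : seq nat * seq nat) : set (nat -> bool) :=
  [set x | exists z, mkseq z (size ab.1) = ab.1 /\ p z = x] `&`
  [set x | exists z, mkseq z (size ab.2) = ab.2 /\ q z = x].
have analytic_word f (a : seq nat) : seq_continuous f ->
    analytic [set x | exists z, mkseq z (size a) = a /\ f z = x].
  move=> fc; exists (fun z x => mkseq z (size a) = a /\ f z = x) => //.
  by apply: closedrel_and; [apply: closedrel_word|apply: closedrel_graph].
have aD ab : analytic (D ab) by apply: analytic_setI; apply: analytic_word.
have /choice[W WP] : forall ab, exists W, [/\ borelc W, indep S W & indep S (D ab) -> D ab `<=` W].
  move=> ab; have [iD|nD] := pselect (indep S (D ab)).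
    by have [W [bW iW DW]] := indep_borelc_hull (aD ab) iD; exists W.
  by exists set0; split=> //; exact: borelc_set0.
have [|x xW] := @indep_not_cover S (fun n =>
    if @unpickle (seq nat * seq nat)%type n is Some ab then W ab else set0) Sinf.
  move=> n; case: unpickle => [ab|]; first by have [] := WP ab.
  by split; first exact: borelc_set0.
have : @nbhs _ (Topological.Pack s * Topological.Pack t)%type (x, x) (~` flip_graph S).
  apply: open_nbhs_nbhs; split; first exact: closed_openC.
  exact: flip_graph_irr.
move=> [[P Q] [/= xP xQ] PQ].
have [z zx] := psurj x; have [y yx] := qsurj x.
rewrite -zx in xP; rewrite -yx in xQ.
have [m mP] := pc z P xP; have [n nQ] := qc y Q xQ.
have word_agree k (a b : nat -> nat) : mkseq b k = mkseq a k -> agree k a b.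
  by move=> ab i ik; have := congr1 (fun s => nth 0 s i) ab; rewrite !nth_mkseq.
pose ab := (mkseq z m, mkseq y n).
have [_ _ DW] := WP ab.
apply: (xW (pickle ab)); rewrite pickleK; apply: DW; last first.
  by split; [exists z|exists y]; rewrite size_mkseq.
move=> u k [[zu [+ zuE]] _] uk Su [_ [yu [+ yuE]]]; rewrite /= !size_mkseq.
move=> /word_agree/mP; rewrite zuE => Pu /word_agree/nQ; rewrite yuE => Qu.
by apply: (PQ (u, xorw (delta k) u)) => //; exists k.
Qed.

Lemma flip_graph_minimal (R : realType) (S : nat -> bool) (Y Y' : topologicalType)
    (B : set (Y * Y')) :
  (forall n, exists m, forall c, exists2 j, j <= m & forall i, i <= n -> S (c + j + i) = S i) ->
  polish R Y -> polish R Y' -> ~ pot_closed R B ->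
  red_c B (flip_graph S : set (cantor_space * cantor_space)) ->
  red_c (flip_graph S : set (cantor_space * cantor_space)) B.
Proof.
move=> Srec pY pY' nB [u [v [uc vc BE]]].
pose D : set (nat -> bool) := [set x | (exists y, u y = x) /\ exists y', v y' = x].
(* In the small case the preimages of the [F i] are made open. A point outside [B] with [u y = v y']
   then has a neighbourhood mapped into one independent [F i]; with distinct values, the original
   topologies suffice. *)
have [[F [FP DF]]|nsD] := pselect (small D).
  case: nB.
  have un x n : nbhs x [set y | agree n (u x) (u y)] by apply: uc (nbhs_agree _ n).
  have vn x n : nbhs x [set y | agree n (v x) (v y)] by apply: vc (nbhs_agree _ n).
  have bF i : borelc (F i) by have [] := FP i.
  have [s fs sF] := finer_polish_open pY un bF.
  have [t ft tF] := finer_polish_open pY' vn bF.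
  exists s, t; split=> //.
  rewrite -openC openE => -[y y'] nByy'.
  have [uv|nuv] := pselect (u y = v y').
    have [i _ Fi] : (\bigcup_i F i) (u y).
      by apply: DF; split; [exists y|exists y'].
    exists (u @^-1` F i, v @^-1` F i).
      split=> /=; first by apply: (@open_nbhs_nbhs (Topological.Pack s)).
      by apply: (@open_nbhs_nbhs (Topological.Pack t)); split=> //; rewrite /preimage /= -uv.
    move=> [a a'] [/= Fa Fa']; rewrite BE => -[k /= [ak _ aE]].
    by have [_ /(_ (u a) k Fa ak isT)] := FP i; apply; rewrite -aE.
  have : off_flip_graph S (u y, v y') by split=> //; move: nByy'; rewrite BE.
  move=> /off_flip_graph_near[n nP].
  exists ([set a | agree n (u y) (u a)], [set a | agree n (v y') (v a)]).
    by split=> /=; [exact: (finer_polish_nbhs fs)|exact: (finer_polish_nbhs ft)].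
  by move=> [a a'] [/= /nP ya /ya[_]]; rewrite BE.
(* Both spaces are nonempty since [D] is, and so they are images of the Baire space. *)
have [y0 [y0' _]] : exists (y : Y) (y' : Y'), True.
  apply: contrapT => nyy'; apply: nsD; exists (fun=> set0); split=> [_|x [[y _] [y' _]]].
    by split=> //; exact: borelc_set0.
  by case: nyy'; exists y, y'.
have [p [pc psurj]] := polish_image_baire y0 pY.
have [q [qc qsurj]] := polish_image_baire y0' pY'.
have upc : seq_continuous (u \o p)
  by move=> z n; apply: (pc z [set a | agree n (u (p z)) (u a)]); apply: uc (nbhs_agree _ n).
have vqc : seq_continuous (v \o q)
  by move=> z n; apply: (qc z [set a | agree n (v (q z)) (v a)]); apply: vc (nbhs_agree _ n).
have [|f [g [fc gc fgP]]] := cantor_scheme upc vqc Srec.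
  apply: contra_not nsD; apply: small_sub => x [[y <-] [y' y'E]]; split.
    by have [z <-] := psurj y; exists z.
  by have [z zE] := qsurj y'; exists z; rewrite /= zE.
exists (p \o f), (q \o g); split.
- apply/continuous_cantorP => x U /pc[n nP]; have [m mP] := fc x n.
  by exists m => y /mP/nP.
- apply/continuous_cantorP => x U /qc[n nP]; have [m mP] := gc x n.
  by exists m => y /mP/nP.
- rewrite BE; apply/seteqP; split=> -[x y] /=.
    by move=> /fgP.
  by move=> h; apply/fgP.
Qed.

Theorem theorem5 (R : realType) :
  exists A : cantor_space -> set (cantor_space * cantor_space),
    [/\ forall a : cantor_space, diff_open (A a),
        perfect_antichain
          (@red_c cantor_space cantor_space cantor_space cantor_space) A &
        forall a : cantor_space, minimal_non_pot_closed R (A a)].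
Proof.
pose A (a : cantor_space) : set (cantor_space * cantor_space) :=
  flip_graph (toep (spread a)).
have Arec a n := toep_recurrent (spread a) n.
have Ainf a c : exists j, toep (spread a) (c + j).
  by have [m /(_ c)[j _ /(_ 0 isT)]] := Arec a 0; rewrite addn0 => h; exists j; rewrite h.
have Abor a : borel (A a) by exact: borel_diff_open (diff_open_flip_graph _).
exists A; split=> [a||a]; first exact: diff_open_flip_graph.
  split=> // [a b nab [u [v [/continuous_seq_continuous uc /continuous_seq_continuous vc AE]]]|].
    have uvP x y : flip_graph (toep (spread a)) (x, y) <->
        flip_graph (toep (spread b)) (u x, v y).
      by change (A a (x, y) <-> A b (u x, v y)); rewrite AE.
    have uv := flip_graph_reduction_eq (Ainf a) uc vc uvP; subst v.
    apply: nab; apply: spread_inj; apply: toep_prefixes_eq.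
      by move=> c n; have [i] := spread_onto b c n; exists i.
    (* The omitted argument is the condition at 0: the first letter of [toep (spread a)] is that of
       [spread a], which is 1. *)
    exact: flip_graph_rigid uc _ uvP.
  exists (fun a => flip_code (toep (spread a))).
    exact/continuous_seq_continuous/flip_code_seq_continuous.
  by move=> a; apply: borel_code_flip_graph.
split; [exact: Abor|exact: flip_graph_not_pot_closed (Ainf a)|].
by move=> Y Y' B pY pY' _ nB; apply: flip_graph_minimal (Arec a) pY pY' nB.
Qed.
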